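(* For all integers $m,h,k$ with $1\le h<k$, $\gcd(h,k)=1$ and $0\le m<k$, $$\frac1k\log\left|\frac{1}{\Pi_m(h/k)}\right|=\frac{\mathrm{Cl}_2(2\pi m\gamma_0/k)}{2\pi|\beta_0\gamma_0|}+O\left(\frac{\log k}{\sqrt k}\right),$$ where $(\beta_0,\gamma_0)$ is any pair in $Z(h,k)$ with $|\beta_0\gamma_0|$ minimal. The implied constant is absolute; in fact the error term is bounded in absolute value by $(16.05+\frac{\sqrt2}{\pi}\log k)/\sqrt k$.
   Context: $\Pi_m(\theta):=\prod_{j=1}^m2\sin(\pi j\theta)$, $\Pi_0:=1$. $\mathrm{Cl}_2(\theta):=-\int_0^\theta\log|2\sin(x/2)|\,dx=\sum_{n\ge1}\sin(n\theta)/n^2$ for $\theta\in\mathbb R$. $Z(h,k):=\{(\beta,\gamma)\in\mathbb Z^2:\ 1\le|\beta|<k,\ 1\le\gamma<k,\ \beta h\equiv\gamma\bmod k\}$. *)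

(* Defs.v *)
From HB Require Import structures.
From mathcomp Require Import all_boot all_order all_algebra.
From mathcomp Require Import all_classical all_reals all_analysis.

Set Implicit Arguments.
Unset Strict Implicit.
Unset Printing Implicit Defensive.

Import Order.TTheory GRing.Theory Num.Theory.
Import numFieldNormedType.Exports.

Local Open Scope classical_set_scope.
Local Open Scope ring_scope.

Definition sinprod (R : realType) (m : nat) (theta : R) : R :=
  \prod_(1 <= j < m.+1) (2 * sin (pi * j%:R * theta)).

(* The integral is oriented, so its sign flips for theta < 0. The integrand is
   integrable on bounded intervals; at its singularities, which form a null
   set, it takes the value ln 0 = 0. *)
Definition Cl2 (R : realType) (theta : R) : R :=
  if 0 <= theta
  then - \int[@lebesgue_measure R]_(x in `[0, theta]) ln `|2 * sin (x / 2)|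
  else \int[@lebesgue_measure R]_(x in `[theta, 0]) ln `|2 * sin (x / 2)|.

Definition Zset (h k : nat) : set (int * int) :=
  [set p | [/\ 1 <= `|p.1| < k%:Z, 1 <= p.2 < k%:Z
             & (p.1 * h%:Z = p.2 %[mod k%:Z])%Z]].

Definition Zmin (h k : nat) : set (int * int) :=
  [set p | Zset h k p /\
           forall q, Zset h k q -> `|p.1 * p.2| <= `|q.1 * q.2|].

Definition error_term (R : realType) (m h k : nat) (beta0 gamma0 : int) : R :=
  k%:R^-1 * ln `|1 / sinprod m (h%:R / k%:R : R)|
  - Cl2 (2 * pi * m%:R * gamma0%:~R / k%:R)
    / (2 * pi * `|beta0 * gamma0|%:~R).

(* Main.v *)
(** The Fourier expansion - ln |2 sin (x / 2)| = sum_n cos (n x) / n, cut at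
    n < k with an explicit error, turns - ln |Pi_m (h / k)| into
    sum_(n < k) (1 / n) sum_(j <= m) cos (2 pi j n h / k).  Writing s_n for the
    representative of n h mod k of least absolute value, the inner sum is
    k sin (2 pi m s_n / k) / (2 pi s_n) + O(1), so up to O(ln k / k)
      (1 / k) ln |1 / Pi_m (h / k)|
        = (1 / 2 pi) sum_(n < k) sin (2 pi m s_n / k) / (n s_n).
    The pairs (n, s_n) lie in the lattice {(n, s) | s = n h mod k}, in which the
    determinant of two vectors is a multiple of k.  Those parallel to
    (beta0, gamma0) are its multiples, and they sum up to the Fourier series of
    Cl2.  For the others, nonzero determinants and the minimality of
    |beta0 gamma0| give n |s_n| >= sqrt (k / 2).  Their contribution is split
    into n >= sqrt (2 k), where the s_n are distinct, |s_n| >= sqrt (k / 8), and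
    a box so small that all its lattice points are multiples of one vector. *)

Require Import Defs.
From HB Require Import structures.
From mathcomp Require Import all_boot all_order all_algebra.
From mathcomp Require Import all_classical all_reals all_analysis.
From mathcomp Require Import measurable_realfun ring lra zify.

Set Implicit Arguments.
Unset Strict Implicit.
Unset Printing Implicit Defensive.

Import Order.TTheory GRing.Theory Num.Theory.
Import numFieldNormedType.Exports.

Local Open Scope classical_set_scope.
Local Open Scope ring_scope.

(** * The Fourier series of ln |2 sin (x / 2)| *)

Section CosineSeries.
Variable R : realType.
Implicit Types (x y : R) (n m N K : nat).

Lemma ler_is_derive (f df : R -> R) (a b : R) : a <= b ->
    (forall x, a <= x <= b -> is_derive x 1 f (df x)) ->
    (forall x, a <= x <= b -> 0 <= df x) ->
  f a <= f b.
Proof.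
move=> leab fdf df0.
have fdf' x : x \in `]a, b[ -> is_derive x 1 f (df x).
  by rewrite in_itv /= => /andP[ax xb]; apply: fdf; rewrite !ltW.
have fC : {within `[a, b], continuous f}.
  apply: derivable_within_continuous => x; rewrite in_itv /= => xab.
  exact: (@ex_derive _ _ _ _ _ _ _ (fdf x xab)).
have [c cab fE] := MVT_segment leab fdf' fC.
by rewrite -subr_ge0 fE mulr_ge0 ?subr_ge0// df0//; move: cab; rewrite in_itv.
Qed.

Lemma ger_is_derive (f df : R -> R) (a b : R) : a <= b ->
    (forall x, a <= x <= b -> is_derive x 1 f (df x)) ->
    (forall x, a <= x <= b -> df x <= 0) ->
  f b <= f a.
Proof.
move=> leab fdf df0; rewrite -lerN2.
apply: (@ler_is_derive (fun z => - f z) (fun z => - df z)) => // x xab.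
  by have dfx := fdf x xab; exact: is_deriveN.
by rewrite oppr_ge0 df0.
Qed.

(** * Logarithms and harmonic sums *)

Lemma ln_sub_le x y : 0 < x -> 0 < y -> ln y - ln x <= (y - x) / x.
Proof.
move=> x0 y0; rewrite -ln_div ?posrE//.
have -> : y / x = 1 + (y - x) / x by field; lra.
have yx0 : 0 < y / x by rewrite divr_gt0.
have yxE : (y - x) / x = y / x - 1 by field; lra.
by apply: le_ln1Dx; rewrite yxE; lra.
Qed.

Lemma ln_succ_ge n : (0 < n)%N -> n.+1%:R^-1 <= ln n.+1%:R - ln n%:R :> R.
Proof.
move=> n0; have n0R : 0 < n%:R :> R by rewrite ltr0n.
have := @ln_sub_le n.+1%:R n%:R (ltr0Sn _ _) n0R.
rewrite -[n.+1]addn1 natrD => h.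
have -> : (n%:R + 1 : R)^-1 = - ((n%:R - (n%:R + 1)) / (n%:R + 1)) by field; lra.
lra.
Qed.

Lemma ln_succ_le n : (0 < n)%N -> ln n.+1%:R - ln n%:R <= n%:R^-1 :> R.
Proof.
move=> n0; have n0R : 0 < n%:R :> R by rewrite ltr0n.
apply: le_trans (@ln_sub_le n%:R n.+1%:R n0R (ltr0Sn _ _)) _.
by rewrite -[n.+1]addn1 natrD addrAC subrr add0r mul1r.
Qed.

Definition harmonic_sum n : R := \sum_(1 <= i < n) i%:R^-1.

Lemma harmonic_sumS n : (0 < n)%N ->
  harmonic_sum n.+1 = harmonic_sum n + n%:R^-1.
Proof. by move=> n0; rewrite /harmonic_sum big_nat_recr. Qed.

Lemma harmonic_sum_le n : (0 < n)%N -> harmonic_sum n.+1 <= 1 + ln n%:R.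
Proof.
elim: n => // -[_ _|n IH _].
  by rewrite /harmonic_sum big_nat1 invr1 ln1 addr0.
rewrite harmonic_sumS//; have := IH isT; have := @ln_succ_ge n.+1 isT.
by set v := _^-1 => *; lra.
Qed.

Lemma harmonic_sum_lt n : (0 < n)%N -> harmonic_sum n <= 1 + ln n%:R.
Proof.
move=> n0; apply: le_trans (harmonic_sum_le n0).
by rewrite harmonic_sumS// lerDl invr_ge0.
Qed.

Lemma harmonic_sum_sub_le n m : (0 < n)%N -> (n <= m)%N ->
  harmonic_sum m.+1 - harmonic_sum n.+1 <= ln m%:R - ln n%:R.
Proof.
move=> n0; elim: m => [|m IH]; first by rewrite leqn0 => /eqP n0'; rewrite n0' in n0.
rewrite leq_eqVlt => /orP[/eqP <-|]; first by rewrite !subrr.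
rewrite ltnS => nm; rewrite harmonic_sumS//; have := IH nm.
have := @ln_succ_ge m (leq_trans n0 nm).
by set v := _^-1 => *; lra.
Qed.

Lemma harmonic_sum_sub_ge n m : (n <= m)%N ->
  ln m.+1%:R - ln n.+1%:R <= harmonic_sum m.+1 - harmonic_sum n.+1.
Proof.
elim: m => [|m IH]; first by rewrite leqn0 => /eqP ->; rewrite !subrr.
rewrite leq_eqVlt => /orP[/eqP <-|]; first by rewrite !subrr.
rewrite ltnS => nm; rewrite harmonic_sumS//; have := IH nm.
have := @ln_succ_le m.+1 isT.
by set v := _^-1 => *; lra.
Qed.

(** Up to 2M the alternating sum is minus the harmonic sum over M < n <= 2M, which telescoping
    logarithms squeeze against [ln 2]; one more term covers odd N. This controls the Fourier series
    at [pi], from which [cos_sum_bound_0pi] starts. *)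
Lemma ln2_alternating N : 
  `|ln 2 + \sum_(1 <= n < N.+1) (-1) ^+ n / n%:R| <= 2 / N.+1%:R :> R.
Proof.
have altE M : \sum_(1 <= n < M.*2.+1) (-1) ^+ n / n%:R
    = - (harmonic_sum M.*2.+1 - harmonic_sum M.+1) :> R.
  elim: M => [|M IH]; first by rewrite /harmonic_sum !big_geq// subrr oppr0.
  rewrite doubleS big_nat_recr//= big_nat_recr//= IH.
  rewrite (@harmonic_sumS M.*2.+2)// (@harmonic_sumS M.*2.+1)// (@harmonic_sumS M.+1)//.
  rewrite !exprS -signr_odd odd_double /= expr0.
  have -> : M.*2.+2%:R = 2 * M.+1%:R :> R by rewrite -doubleS -mul2n natrM.
  rewrite invfM; set u := harmonic_sum _; set v := harmonic_sum _.
  by set a := M.+1%:R^-1; set b := M.*2.+1%:R^-1; field.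
have even M : 0 <= (ln 2 : R) + \sum_(1 <= n < M.*2.+1) (-1) ^+ n / n%:R <= (M.*2.+1%:R^-1 : R).
  rewrite altE; apply/andP; split.
    case: M => [|M]; first by rewrite subrr oppr0 addr0 ln_ge0// ler1n.
    have := @harmonic_sum_sub_le M.+1 M.+1.*2 isT.
    rewrite -addnn leq_addr => /(_ isT); rewrite addnn -mul2n natrM lnM ?posrE ?ltr0n//.
    by move=> *; lra.
  have := @harmonic_sum_sub_ge M M.*2.
  rewrite -addnn leq_addr => /(_ isT); rewrite addnn => h.
  have := @ln_succ_le M.*2.+1 isT.
  have -> : M.*2.+2%:R = 2 * M.+1%:R :> R by rewrite -doubleS -mul2n natrM.
  by rewrite lnM ?posrE ?ltr0n//; set v := _^-1 => *; lra.
have inv_le (a : nat) : a.+1%:R^-1 <= 2 / a.+2%:R :> R.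
  rewrite ler_pdivlMr ?ltr0n// mulrC ler_pdivrMr ?ltr0n//.
  by rewrite -natrM ler_nat; lia.
have inv_le1 (a : nat) : a.+1%:R^-1 <= 2 / a.+1%:R :> R.
  by rewrite ler_pdivlMr ?ltr0n// mulVf ?pnatr_eq0// ler1n.
rewrite -(odd_double_half N); case: (odd N) => /=.
  have /andP[h1 h2] := even N./2.
  rewrite add1n big_nat_recr//= exprS -signr_odd odd_double /= expr0 mulr1.
  apply: le_trans (inv_le N./2.*2); rewrite ler_norml; move: h1 h2.
  set u := (\sum_(_ <= _ < _) _); set v := _^-1; move=> h1 h2; rewrite mulN1r.
  by apply/andP; split; lra.
have /andP[h1 h2] := even N./2.
by rewrite add0n ger0_norm// (le_trans h2)// inv_le1.
Qed.

(** * Closed forms and derivatives of trigonometric sums *)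

Lemma sum_sin_mul x N :
  2 * sin (x / 2) * (\sum_(1 <= n < N.+1) sin (n%:R * x))
  = cos (x / 2) - cos ((N%:R + 2^-1) * x).
Proof.
elim: N => [|N IH]; first by rewrite big_geq// mulr0 add0r mulrC subrr.
rewrite big_nat_recr//= mulrDr IH.
have -> : (N%:R + 2^-1) * x = N.+1%:R * x - x / 2 by rewrite -natr1; field.
have -> : (N.+1%:R + 2^-1) * x = N.+1%:R * x + x / 2 by field.
rewrite cosB cosD; ring.
Qed.

Lemma sum_cos_mul x m :
  2 * sin (x / 2) * (\sum_(1 <= j < m.+1) cos (j%:R * x))
  = sin (m%:R * x) * cos (x / 2) + (cos (m%:R * x) - 1) * sin (x / 2).
Proof.
elim: m => [|m IH]; first by rewrite big_geq// mul0r sin0 cos0; ring.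
rewrite big_nat_recr//= mulrDr IH -[m.+1%:R]natr1.
have -> : (m%:R + 1) * x = m%:R * x + (x / 2 + x / 2) by field.
rewrite !(cosD, sinD).
have := cos2Dsin2 (x / 2).
set c := cos (x / 2); set s := sin (x / 2); set C := cos _; set S := sin _ => h.
apply/eqP; rewrite -subr_eq0; apply/eqP.
have cE : c * c = 1 - s ^+ 2 by rewrite -h; ring.
(* The two sides differ by a multiple of [c * c + s ^+ 2 - 1]. *)
rewrite [LHS](_ : _ = (c * c - (1 - s ^+ 2)) * (- S * c - C * s)); last by ring.
by rewrite cE subrr mul0r.
Qed.

Definition cos_sum N x : R := \sum_(1 <= n < N.+1) cos (n%:R * x) / n%:R.

Definition sin_sum N x : R := \sum_(1 <= n < N.+1) sin (n%:R * x) / n%:R ^+ 2.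

Lemma is_derive_add (f g : R -> R) x a b :
    is_derive x 1 f a -> is_derive x 1 g b ->
  is_derive x 1 (fun z => f z + g z) (a + b).
Proof. by move=> df dg; exact: is_deriveD. Qed.

Lemma is_derive_scale (c : R) (f : R -> R) x a :
  is_derive x 1 f a -> is_derive x 1 (fun z => c * f z) (c * a).
Proof. by move=> df; exact: is_deriveZ. Qed.

Lemma is_derive_mul (f g : R -> R) x a b :
    is_derive x 1 f a -> is_derive x 1 g b ->
  is_derive x 1 (fun z => f z * g z) (f x * b + g x * a).
Proof. by move=> df dg; exact: is_deriveM. Qed.

Lemma is_derive_comp (f g : R -> R) x a b :
    is_derive (g x) 1 f a -> is_derive x 1 g b ->
  is_derive x 1 (fun z => f (g z)) (b * a).
Proof. by move=> df dg; rewrite mulrC; exact: (is_derive1_comp df dg). Qed.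

Lemma is_derive_linear (a x : R) : is_derive x 1 (fun z => a * z) a.
Proof.
rewrite -{2}[a]mulr1; apply: is_derive_scale; exact: is_derive_id.
Qed.

Lemma is_derive_cosM (a : R) x :
  is_derive x 1 (fun z => cos (a * z)) (- a * sin (a * x)).
Proof.
have -> : - a * sin (a * x) = a * - sin (a * x) by ring.
exact: (is_derive_comp (is_derive_cos _) (is_derive_linear a x)).
Qed.

Lemma is_derive_sinM (a : R) x :
  is_derive x 1 (fun z => sin (a * z)) (a * cos (a * x)).
Proof. exact: (is_derive_comp (is_derive_sin _) (is_derive_linear a x)). Qed.

Lemma is_derive_big_nat (f : nat -> R -> R) (df : nat -> R) N x :
    (forall n, is_derive x 1 (f n) (df n)) ->
  is_derive x 1 (fun z => \sum_(1 <= n < N.+1) f n z) (\sum_(1 <= n < N.+1) df n).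
Proof.
move=> fdf; elim: N => [|N IH].
  rewrite big_geq//; rewrite (_ : (fun=> _) = cst 0); first exact: is_derive_cst.
  by apply/funext => z; rewrite big_geq.
rewrite big_nat_recr//= (_ : (fun=> _) =
    (fun z => \sum_(1 <= n < N.+1) f n z + f N.+1 z)); last first.
  by apply/funext => z; rewrite big_nat_recr.
exact: is_derive_add.
Qed.

Lemma is_derive_cos_sum N x :
  is_derive x 1 (cos_sum N) (- \sum_(1 <= n < N.+1) sin (n%:R * x)).
Proof.
rewrite -sumrN [X in is_derive _ _ _ X](_ : _ =
    \sum_(1 <= n < N.+1) n%:R^-1 * (- n%:R * sin (n%:R * x))); last first.
  apply: eq_big_nat => n /andP[n0 _].
  by rewrite mulrA mulrN mulVf ?mulN1r// pnatr_eq0 -lt0n.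
rewrite (_ : cos_sum N = fun z => \sum_(1 <= n < N.+1) n%:R^-1 * cos (n%:R * z)).
  by apply: is_derive_big_nat => n; apply: is_derive_scale; exact: is_derive_cosM.
by apply/funext => z; apply: eq_bigr => n _; rewrite mulrC.
Qed.

Lemma is_derive_sin_sum N x : is_derive x 1 (sin_sum N) (cos_sum N x).
Proof.
rewrite /cos_sum [X in is_derive _ _ _ X](_ : _ =
    \sum_(1 <= n < N.+1) n%:R ^- 2 * (n%:R * cos (n%:R * x))); last first.
  apply: eq_big_nat => n /andP[n0 _].
  by field; rewrite pnatr_eq0 -lt0n.
rewrite (_ : sin_sum N = fun z => \sum_(1 <= n < N.+1) n%:R ^- 2 * sin (n%:R * z)).
  by apply: is_derive_big_nat => n; apply: is_derive_scale; exact: is_derive_sinM.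
by apply/funext => z; apply: eq_bigr => n _; rewrite mulrC.
Qed.

Lemma sin_half_gt0 x : 0 < x <= pi -> 0 < sin (x / 2).
Proof.
have pi0 := pi_gt0 R.
by move=> /andP[x0 xpi]; apply: sin_gt0_pi; rewrite divr_gt0//=; lra.
Qed.

Lemma cos_natpi n : cos (n%:R * pi) = (-1) ^+ n :> R.
Proof.
elim: n => [|n IH]; first by rewrite mul0r cos0.
by rewrite -natr1 mulrDl mul1r cosDpi IH exprS mulN1r.
Qed.

Lemma cos_sum_pi N : cos_sum N pi = \sum_(1 <= n < N.+1) (-1) ^+ n / n%:R.
Proof. by apply: eq_bigr => i _; rewrite cos_natpi. Qed.

(* The summand [(sin (l x) + s) / (2 l sin (x / 2))], with [s = 1] or [s = -1],
   turns the oscillating derivative of [ln (2 sin (x / 2)) + cos_sum N x] into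
   one of constant sign on [(0, pi]]. *)
Lemma is_derive_fourier_corrected N (s : R) x : 0 < x <= pi ->
  is_derive x 1
    (fun z => ln (2 * sin (2^-1 * z)) + cos_sum N z
       - (sin ((N%:R + 2^-1) * z) + s) * (2 * (N%:R + 2^-1) * sin (2^-1 * z))^-1)
    ((sin ((N%:R + 2^-1) * x) + s) * cos (2^-1 * x)
       / (4 * (N%:R + 2^-1) * sin (2^-1 * x) ^+ 2)).
Proof.
move=> x0pi; have := sin_half_gt0 x0pi; rewrite [x / 2]mulrC => s0.
set l := N%:R + 2^-1; have l0 : 0 < l.
  by rewrite /l; have : 0 <= N%:R :> R := ler0n _ _; move=> ?; lra.
have d1 : is_derive x 1 (fun z => ln (2 * sin (2^-1 * z)))
    (2 * (2^-1 * cos (2^-1 * x)) * (2 * sin (2^-1 * x))^-1).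
  apply: is_derive_comp; last first.
    by apply: is_derive_scale; exact: is_derive_sinM.
  by apply: is_derive1_ln; rewrite mulr_gt0.
have d2 : is_derive x 1 (fun z => (2 * l * sin (2^-1 * z))^-1)
    (- (2 * l * sin (2^-1 * x)) ^- 2 * (2 * l * (2^-1 * cos (2^-1 * x)))).
  apply: is_deriveV; first by rewrite lt0r_neq0// mulr_gt0// mulr_gt0.
  by apply: is_derive_scale; exact: is_derive_sinM.
have d3 : is_derive x 1 (fun z => - (sin (l * z) + s)) (- 1 * (l * cos (l * x) + 0)).
  rewrite (_ : (fun=> _) = (fun z => - 1 * (sin (l * z) + s))); last first.
    by apply/funext => z; rewrite mulN1r.
  apply: is_derive_scale; by apply: is_derive_add; exact: is_derive_sinM.
have := is_derive_add (is_derive_add d1 (is_derive_cos_sum N x)) (is_derive_mul d3 d2).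
move=> /(is_derive_eq) d4.
rewrite (_ : (fun=> _) = (fun z => ln (2 * sin (2^-1 * z)) + cos_sum N z
    + - (sin (l * z) + s) * (2 * l * sin (2^-1 * z))^-1)); last first.
  by apply/funext => z; rewrite mulNr.
apply: d4.
have := sum_sin_mul x N; rewrite -/l [x / 2]mulrC.
rewrite addr0; move: (sin (l * x)) (cos (l * x)) (\sum_(_ <= _ < _) _).
move=> sl cl S hS.
have {hS} -> : S = (cos (2^-1 * x) - cl) / (2 * sin (2^-1 * x)).
  by rewrite -hS; field; lra.
move: s0; move: (sin (2^-1 * x)) (cos (2^-1 * x)) => a b a0.
by field; lra.
Qed.

(** The corrected function increases for [s = 1] and decreases for [s = -1], so comparing [x] with
    [pi], where [ln2_alternating] applies, gives the upper and the lower bound. The correction has a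
    favourable sign at [pi] and size at most [1 / (l sin (x / 2))] at [x]. *)
Lemma cos_sum_bound_0pi N x : 0 < x <= pi ->
  `|ln (2 * sin (x / 2)) + cos_sum N x|
    <= ((N%:R + 2^-1) * sin (x / 2))^-1 + 2 / N.+1%:R.
Proof.
move=> x0pi; have s0 := sin_half_gt0 x0pi.
have pi0 := pi_gt0 R.
case/andP : (x0pi) => x0 xpi.
set l := N%:R + 2^-1; have l0 : 0 < l.
  by rewrite /l; have : 0 <= N%:R :> R := ler0n _ _; move=> ?; lra.
have ge0x z : x <= z <= pi -> 0 < z <= pi.
  by move=> /andP[xz ->]; rewrite (lt_le_trans x0).
have cos0 z : x <= z <= pi -> 0 <= cos (2^-1 * z).
  by move=> /andP[xz zpi]; apply: cos_ge0_pihalf; apply/andP; split; lra.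
have den0 z : x <= z <= pi -> 0 <= (4 * l * sin (2^-1 * z) ^+ 2)^-1.
  by move=> _; rewrite invr_ge0 mulr_ge0 ?sqr_ge0// mulr_ge0// ltW.
have := ln2_alternating N; rewrite -cos_sum_pi => hpi.
pose F s z := ln (2 * sin (2^-1 * z)) + cos_sum N z
       - (sin ((N%:R + 2^-1) * z) + s) * (2 * (N%:R + 2^-1) * sin (2^-1 * z))^-1.
have up : F 1 x <= F 1 pi.
  apply: (ler_is_derive xpi (fun z hz => is_derive_fourier_corrected N 1 (ge0x z hz))).
  move=> z hz; rewrite mulr_ge0 ?den0// mulr_ge0 ?cos0//.
have lo : F (-1) pi <= F (-1) x.
  apply: (ger_is_derive xpi (fun z hz => is_derive_fourier_corrected N (-1) (ge0x z hz))).
  move=> z hz; rewrite mulr_le0_ge0 ?den0// mulr_le0_ge0 ?cos0//.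
move: up lo; rewrite /F -/l [2^-1 * pi]mulrC sin_pihalf !mulr1.
rewrite [2^-1 * x]mulrC -[2 * l * _]mulrA !invfM -/l.
move: hpi; rewrite ler_norml => /andP[hpi1 hpi2].
have := sin_geN1 (l * x); have := sin_le1 (l * x).
have := sin_geN1 (l * pi); have := sin_le1 (l * pi).
move: hpi1 hpi2; set e := 2 / _; set Hpi := ln 2 + _.
set Hx := _ + cos_sum N x; move: (sin (l * x)) (sin (l * pi)) => sx sp.
have : 0 < (l^-1 * (sin (x / 2))^-1) by rewrite mulr_gt0 ?invr_gt0.
have : 0 < l^-1 by rewrite invr_gt0.
set a := l^-1; set q := a * _ => a0 q0 h1 h2 sp1 sp2 sx1 sx2.
have k1 : 0 <= (sp + 1) * a by apply: mulr_ge0; [lra|exact: ltW].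
have k2 : 0 <= (1 - sp) * a by apply: mulr_ge0; [lra|exact: ltW].
have k3 : 0 <= (sx + 1) * q by apply: mulr_ge0; [lra|exact: ltW].
have k4 : 0 <= (1 - sx) * q by apply: mulr_ge0; [lra|exact: ltW].
by move=> ? ?; rewrite ler_norml; apply/andP; split; lra.
Qed.

(** * Elementary bounds for sine and cosine *)

Lemma sin_ge_xcos x : 0 <= x <= pi -> x * cos x <= sin x.
Proof.
move=> /andP[x0 xpi].
have d (z : R) : is_derive z 1 (fun z => sin z + (- 1) * (z * cos z))
   (cos z + (- 1) * (z * - sin z + cos z * 1)).
  apply: is_derive_add; apply: is_derive_scale; apply: is_derive_mul.
have := @ler_is_derive _ _ 0 x x0 (fun z _ => d z) _.
rewrite sin0 mul0r mulr0 addr0 => h; suff : 0 <= sin x + -1 * (x * cos x) by move=> ?; lra.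
apply: h => z /andP[z0 zx].
have : 0 <= z * sin z.
  by rewrite mulr_ge0// sin_ge0_pi// z0 (le_trans zx).
lra.
Qed.

Lemma sin_le_id x : 0 <= x -> sin x <= x.
Proof.
move=> x0.
have d (z : R) : is_derive z 1 (fun z => z + (- 1) * sin z) (1 + (- 1) * cos z).
  by apply: is_derive_add; apply: is_derive_scale.
have := @ler_is_derive _ _ 0 x x0 (fun z _ => d z) _.
rewrite sin0 mulr0 addr0 => h; suff : 0 <= x + -1 * sin x by move=> ?; lra.
by apply: h => z _; have := cos_le1 z; move=> ?; lra.
Qed.

Lemma cos_ge_quadratic x : 0 <= x -> 1 - x ^+ 2 / 2 <= cos x.
Proof.
move=> x0.
have d (z : R) : is_derive z 1 (fun z => cos z + 2^-1 * (z * z)) (- sin z + 2^-1 * (z * 1 + z * 1)).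
  by apply: is_derive_add; apply: is_derive_scale; apply: is_derive_mul.
have := @ler_is_derive _ _ 0 x x0 (fun z _ => d z) _.
rewrite cos0 mulr0 mulr0 addr0 => h; suff : 1 <= cos x + 2^-1 * (x * x) by move=> ?; lra.
by apply: h => z /andP[z0 _]; have := sin_le_id z0; move=> ?; lra.
Qed.

(** By [sin_ge_xcos], [sin z / z] decreases on [(0, pi / 2]], so it is least at [pi / 2]. *)
Lemma sin_ge_jordan x : 0 <= x <= pi / 2 -> 2 / pi * x <= sin x.
Proof.
move=> /andP[]; rewrite le_eqVlt => /orP[/eqP <- _|x0 xpi].
  by rewrite mulr0 sin0.
have pi0 := pi_gt0 R.
have d (z : R) : x <= z <= pi / 2 ->
    is_derive z 1 (fun z => z^-1 * sin z) (z^-1 * cos z + sin z * (- z ^- 2 * 1)).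
  move=> /andP[xz _]; apply: is_derive_mul; apply: is_deriveV.
  by rewrite lt0r_neq0// (lt_le_trans x0).
have := @ger_is_derive _ _ x (pi / 2) xpi d _.
rewrite sin_pihalf mulr1 invf_div => h.
suff h1 : 2 / pi <= x^-1 * sin x by rewrite -ler_pdivlMr// [sin x / x]mulrC.
apply: h => z /andP[xz zpi].
have z0 : 0 < z := lt_le_trans x0 xz.
have : z * cos z <= sin z by apply: sin_ge_xcos; apply/andP; split; lra.
rewrite -subr_ge0 => h.
rewrite (_ : _ + _ = - ((sin z - z * cos z) / z ^+ 2)).
  by rewrite oppr_le0 divr_ge0// sqr_ge0.
by field; lra.
Qed.

(** [cos (n x)] is a Chebyshev polynomial in [cos x]; because of the two-step recurrence the
    induction carries two consecutive indices. *)
Lemma cos_natmul_eq x y : cos x = cos y -> forall n, cos (n%:R * x) = cos (n%:R * y).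
Proof.
move=> cxy.
have rec n (z : R) : cos (n.+2%:R * z) = 2 * cos z * cos (n.+1%:R * z) - cos (n%:R * z).
  have -> : n.+2%:R * z = n.+1%:R * z + z by rewrite -[n.+2%:R]natr1; ring.
  have -> : n%:R * z = n.+1%:R * z - z by rewrite -[n.+1%:R]natr1; ring.
  by rewrite cosD cosB; ring.
suff h n : cos (n%:R * x) = cos (n%:R * y) /\ cos (n.+1%:R * x) = cos (n.+1%:R * y).
  by move=> n; case: (h n).
elim: n => [|n [IH1 IH2]]; first by rewrite !mul0r !mul1r.
by split=> //; rewrite !rec IH1 IH2 cxy.
Qed.

Lemma sin_half_sqr x : sin (x / 2) ^+ 2 = (1 - cos x) / 2.
Proof.
have -> : cos x = cos (x / 2 + x / 2) by congr cos; field.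
by rewrite cosD; have := cos2Dsin2 (x / 2) => h; lra.
Qed.

Lemma norm_sin_half_eq x y : cos x = cos y -> `|sin (x / 2)| = `|sin (y / 2)|.
Proof.
move=> cxy; apply/eqP; rewrite -(@eqrXn2 _ 2)//.
by rewrite !real_normK ?num_real// !sin_half_sqr cxy.
Qed.

(** Take [y = acos (cos x)]: the Fourier estimate depends on [x] only through [cos x], so bounds
    proved on [(0, pi]] hold wherever [sin (x / 2)] is nonzero. *)
Lemma fold_angle x : sin (x / 2) != 0 -> exists y : R,
  [/\ 0 < y <= pi, `|sin (x / 2)| = sin (y / 2) &
      forall n, cos (n%:R * x) = cos (n%:R * y)].
Proof.
move=> s0.
have c1 : cos x < 1.
  have : 0 < sin (x / 2) ^+ 2 by rewrite exprn_even_gt0.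
  by rewrite sin_half_sqr => ?; lra.
have cK : cos (acos (cos x)) = cos x by apply: acosK; rewrite in_itv /= cos_geN1 cos_le1.
exists (acos (cos x)); have y0 : 0 < acos (cos x) <= pi.
  by rewrite acos_gt0 ?cos_geN1//= acos_lepi// cos_geN1 cos_le1.
split => //; last exact: cos_natmul_eq.
by rewrite -(norm_sin_half_eq cK) gtr0_norm// sin_half_gt0.
Qed.

Lemma cos_sum_bound N x : sin (x / 2) != 0 ->
  `|ln `|2 * sin (x / 2)| + cos_sum N x|
    <= ((N%:R + 2^-1) * `|sin (x / 2)|)^-1 + 2 / N.+1%:R.
Proof.
move=> /fold_angle[y [y0 sE cE]].
rewrite normrM sE ger0_norm//.
have -> : cos_sum N x = cos_sum N y by apply: eq_bigr => n _; rewrite cE.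
exact: cos_sum_bound_0pi.
Qed.

Lemma inv_half_shift_le N (s : R) : 0 < s ->
  ((N%:R + 2^-1) * s)^-1 <= 2 / s / N.+1%:R.
Proof.
move=> s0; have N0 : 0 <= N%:R :> R := ler0n _ _.
have -> : 2 / s / N.+1%:R = (2^-1 * (s * N.+1%:R))^-1 by rewrite !invfM invrK mulrA.
have l0 : 0 < N%:R + 2^-1 :> R by lra.
rewrite lef_pV2 ?posrE ?mulr_gt0// ?invr_gt0// ?ltr0n// -[N.+1%:R]natr1 mulrCA mulrC ler_pM2r//.
lra.
Qed.

Lemma cvg_cos_sum x : sin (x / 2) != 0 ->
  cos_sum N x @[N --> \oo] --> - ln `|2 * sin (x / 2)|.
Proof.
move=> s0; have n0 : 0 < `|sin (x / 2)| by rewrite normr_gt0.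
pose c := 2 / `|sin (x / 2)| + 2.
have c0 : 0 < c by rewrite addr_gt0// divr_gt0.
apply/cvgrPdist_le => e e0.
have e1 : 0 < e / c by rewrite divr_gt0.
near=> N.
rewrite -opprD normrN (le_trans (cos_sum_bound _ s0))//.
have N1 : N.+1%:R^-1 < e / c by near: N; exact: (near_infty_natSinv_lt (PosNum e1)).
apply: (@le_trans _ _ (c * N.+1%:R^-1)); last first.
  by rewrite mulrC -ler_pdivlMr// ltW.
by rewrite /c [leRHS]mulrDl lerD2r inv_half_shift_le.
Unshelve. all: by end_near. Qed.

Lemma ln2_le1 : ln 2 <= 1 :> R.
Proof. by have := @le_ln1Dx R 1; rewrite -[1 + 1]/2; apply; lra. Qed.

Lemma pi_le4 : pi <= 4 :> R.
Proof. by have := @pihalf_lt2 R; move=> ?; lra. Qed.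

Lemma ln_norm_sin_le x : ln `|2 * sin x| <= 1 :> R.
Proof.
have [->|s0] := eqVneq (sin x) 0; first by rewrite mulr0 normr0 ln0.
apply: le_trans ln2_le1; rewrite ler_ln ?posrE ?normr_gt0 ?mulf_neq0 ?pnatr_eq0//.
by rewrite normrM ger0_norm// ger_pMr// sin_max.
Qed.

Lemma cos_sum_le_harmonic N x : cos_sum N x <= harmonic_sum N.+1.
Proof.
apply: ler_sum_nat => n _; rewrite ler_piMl ?invr_ge0 ?ler0n// cos_le1.
Qed.

(** Bounds uniform in [N], for Fatou's lemma and dominated convergence. If [(N + 1/2) y >= 1], the
    error in [cos_sum_bound_0pi] is at most 6. Otherwise all cosines are nonnegative and, for
    [N >= 1], the sum is at most [1 + ln N <= 1 - ln y], while [2 sin (y / 2) <= y]. *)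
Lemma cos_sum_estimate N x : sin (x / 2) != 0 ->
  -8 <= cos_sum N x /\ `|cos_sum N x| <= 8 - ln `|2 * sin (x / 2)|.
Proof.
move=> s0; have [y [y0pi sE cE]] := fold_angle s0.
have f1 := ln_norm_sin_le (x / 2).
have := cos_sum_bound N s0; rewrite sE.
have -> : cos_sum N x = cos_sum N y by apply: eq_bigr => n _; rewrite cE.
have fE : ln `|2 * sin (x / 2)| = ln (2 * sin (y / 2)).
  by rewrite normrM sE ger0_norm.
have sy0 := sin_half_gt0 y0pi; have /andP[y0 ypi] := y0pi.
have pi0 := pi_gt0 R; have pi4 := pi_le4.
set f := ln _ in f1 fE *.
have N0 : 0 <= N%:R :> R := ler0n _ _.
case: (lerP 1 ((N%:R + 2^-1) * y)) => [ly|ly].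
  have e2 : 2 / N.+1%:R <= 2 :> R by rewrite ler_pdivrMr ?ltr0n// ler_peMr// ler1n.
  (* Jordan's inequality gives [(N + 1/2) sin (y / 2) >= 1 / pi], and [pi <= 4]. *)
  have e1 : ((N%:R + 2^-1) * sin (y / 2))^-1 <= 4.
    rewrite (le_trans _ pi4)// -[leRHS]invrK lef_pV2 ?posrE ?invr_gt0//; last first.
      by rewrite mulr_gt0//; lra.
    have : 2 / pi * (y / 2) <= sin (y / 2).
      by apply: sin_ge_jordan; apply/andP; split; lra.
    rewrite (_ : 2 / pi * (y / 2) = pi^-1 * y); last by field; lra.
    have : 0 < pi^-1 :> R by rewrite invr_gt0.
    move: (pi^-1) (sin (y / 2)) => p s p0 ps; apply: le_trans (_ : (N%:R + 2^-1) * (p * y) <= _).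
      by rewrite mulrCA ler_peMr// ltW.
    by rewrite ler_wpM2l//; lra.
  move=> h; have {}h : `|f + cos_sum N y| <= 6 by apply: le_trans h (le_trans (lerD e1 e2) _); lra.
  move: h; rewrite ler_norml => /andP[h1 h2]; split; first by lra.
  by rewrite ler_norml; apply/andP; split; lra.
move=> _.
have c0 n : (n <= N)%N -> 0 <= cos (n%:R * y).
  move=> nN; have nN' : n%:R <= N%:R :> R by rewrite ler_nat.
  have n0 : 0 <= n%:R :> R := ler0n _ _.
  have pi2 := pi_ge2 R.
  have ny : n%:R * y <= N%:R * y by rewrite ler_wpM2r// ltW.
  have ny0 : 0 <= n%:R * y by rewrite mulr_ge0// ltW.
  by apply: cos_ge0_pihalf; apply/andP; split; lra.
have s0' : 0 <= cos_sum N y.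
  rewrite /cos_sum big_nat; apply: sumr_ge0 => n /andP[_ nN].
  by rewrite divr_ge0// c0.
split; first by lra.
rewrite ger0_norm//.
case: N N0 ly c0 s0' => [|N] N0 ly _ _; first by rewrite /cos_sum big_geq//; lra.
apply: le_trans (cos_sum_le_harmonic _ _) _.
apply: le_trans (harmonic_sum_le _) _ => //.
have fy : f <= ln y.
  rewrite fE ler_ln ?posrE ?mulr_gt0//.
  have : sin (y / 2) <= y / 2 by apply: sin_le_id; lra.
  by move=> ?; lra.
suff : ln N.+1%:R <= - ln y by move=> ?; lra.
rewrite -lnV ?posrE// ler_ln ?posrE ?ltr0n ?invr_gt0// -[_^-1]mul1r ler_pdivlMr//.
by lra.
Qed.

(** At the zeros of [sin (x / 2)] every cosine is 1, so the lower bound holds at every point, as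
    Fatou's lemma requires. *)
Lemma cos_sum_geN8 N x : -8 <= cos_sum N x.
Proof.
have [s0|s0] := eqVneq (sin (x / 2)) 0; last by case: (cos_sum_estimate N s0).
have c1 : cos x = cos 0.
  by have := sin_half_sqr x; rewrite s0 expr0n /= cos0 => ?; lra.
have : 0 <= cos_sum N x.
  by apply: sumr_ge0 => n _; rewrite (cos_natmul_eq c1) mulr0 cos0 divr_ge0.
by move=> ?; lra.
Qed.

(** Telescoping, as [1 / n^2 <= 2 / n - 2 / (n + 1)] for [n >= 1]. *)
Lemma sum_inv_sqr_le (a b : nat) : (0 < a)%N ->
  \sum_(a <= n < b) (n%:R ^- 2 : R) <= 2 / a%:R.
Proof.
move=> a0; case: (leqP b a) => ab; first by rewrite big_geq// divr_ge0.
apply: (@le_trans _ _ (\sum_(a <= n < b) (- (2 / n.+1%:R) - - (2 / n%:R) : R))).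
  apply: ler_sum_nat => n /andP[an _].
  have n0 : (1 : R) <= n%:R by rewrite ler1n (leq_trans a0).
  rewrite -natr1 opprK addrC -mulrBr -subr_ge0.
  rewrite (_ : _ - _ = (n%:R - 1) / (n%:R ^+ 2 * (n%:R + 1))); last by field; lra.
  by rewrite divr_ge0// ?mulr_ge0 ?sqr_ge0//; lra.
by rewrite telescope_sumr 1?ltnW// opprK gerDr oppr_le0 divr_ge0.
Qed.

Lemma sin_sum_cauchy N M x : (N <= M)%N ->
  `|sin_sum M x - sin_sum N x| <= 2 / N.+1%:R.
Proof.
move=> NM; rewrite /sin_sum (@big_cat_nat _ _ _ N.+1)//= addrAC subrr add0r.
apply: le_trans (sum_inv_sqr_le M.+1 (ltn0Sn N)).
apply: le_trans (ler_norm_sum _ _ _) _; apply: ler_sum => n _.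
by rewrite normrM normfV [`|_ ^+ 2|]ger0_norm ?sqr_ge0// ler_piMl ?invr_ge0 ?sqr_ge0// sin_max.
Qed.

(** * The Clausen function *)

Lemma sin_sum0 N : sin_sum N (0 : R) = 0.
Proof. by rewrite /sin_sum big1// => n _; rewrite mulr0 sin0 mul0r. Qed.

Local Notation mu := (@lebesgue_measure R).

(** [c = 8] makes the integrand nonnegative for Fatou's lemma; [c = 0] gives the partial sums of the
    Clausen series. *)
Lemma integral_cos_sum N (c b : R) : 0 < b ->
  (\int[mu]_(x in `[0%R, b]) (cos_sum N x + c)%:E = (sin_sum N b + c * b)%:E)%E.
Proof.
move=> b0.
have d (x : R) : is_derive x 1 (fun z => sin_sum N z + c * z) (cos_sum N x + c).
  by apply: is_derive_add; [exact: is_derive_sin_sum|exact: is_derive_linear].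
have dc (x : R) : is_derive x 1 (fun z => cos_sum N z + c)
    (- \sum_(1 <= n < N.+1) sin (n%:R * x) + 0).
  by apply: is_derive_add; exact: is_derive_cos_sum.
have cont (x : R) : {for x, continuous (fun z => sin_sum N z + c * z)}.
  apply: differentiable_continuous; apply/derivable1_diffP.
  exact: (@ex_derive _ _ _ _ _ _ _ (d x)).
rewrite (@continuous_FTC2 _ _ (fun z => sin_sum N z + c * z))//.
- by rewrite sin_sum0 mulr0 addr0 sube0.
- apply: derivable_within_continuous => x _.
  exact: (@ex_derive _ _ _ _ _ _ _ (dc x)).
- split.
  + by move=> x _; exact: (@ex_derive _ _ _ _ _ _ _ (d x)).
  + by apply: cvg_at_right_filter; exact: cont.
  + by apply: cvg_at_left_filter; exact: cont.
- by move=> x _; rewrite derive1E; exact: (@derive_val _ _ _ _ _ _ _ (d x)).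
Qed.

Lemma sin_eq0_ge0 x : 0 <= x -> sin x = 0 -> exists n, x = pi *+ n.
Proof.
move=> x0 sx; have pi0 := pi_gt0 R.
pose n := Num.truncn (x / pi); exists n.
have /truncn_itv /andP[h1 h2] : 0 <= x / pi by rewrite divr_ge0// ltW.
rewrite ler_pdivlMr// in h1; rewrite ltr_pdivrMr// in h2.
have xE : x = (x - pi *+ n) + pi *+ n by rewrite subrK.
move: sx; rewrite {1}xE (alternatingn (@sinDpi R)) => /eqP.
rewrite mulf_eq0 signr_eq0 /= => /eqP sx.
apply/eqP; rewrite -subr_eq0; apply/eqP.
have t0 : 0 <= x - pi *+ n by rewrite subr_ge0 -mulr_natl.
have t1 : x - pi *+ n < pi.
  by rewrite ltrBlDr -mulr_natl; move: h2; rewrite -natr1 mulrDl mul1r addrC.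
apply/eqP; rewrite eq_le t0 andbT leNgt; apply/negP => t2.
by have := @sin_gt0_pi R (x - pi *+ n); rewrite t2 t1 sx ltxx => /(_ isT).
Qed.

(** The zeros of [sin (x / 2)] in [[0, b]] are among the countably many points [2 pi n], which form
    a null set. *)
Lemma ae_sin_half_neq0 (b : R) (P : R -> Prop) :
    (forall x, (0 <= x <= b -> sin (x / 2) != 0) -> P x) ->
  {ae mu, forall x, P x}.
Proof.
pose Z := range (fun n => 2 * (pi *+ n) : R).
have cZ : countable Z by apply: card_le_trans (card_image_le _ _) _; exact: countableP.
move=> HP; exists Z; split.
- exact: countable_measurable.
- exact: countable_lebesgue_measure0.
- move=> x /= nP; apply: contrapT => nZ; apply/nP/HP => /andP[x0 _].
  apply/negP => /eqP s0; apply: nZ.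
  have [|n nE] := sin_eq0_ge0 _ s0; first by rewrite divr_ge0.
  by exists n => //; rewrite -nE; field.
Qed.

Lemma measurable_ln_sin (D : set R) : measurable D ->
  measurable_fun D (fun x : R => ln `|2 * sin (x / 2)|).
Proof.
move=> mD; apply: (@measurableT_comp _ _ _ _ _ _ (@ln R)); first exact: measurable_ln.
apply: (@measurableT_comp _ _ _ _ _ _ (@Num.norm R R)); first exact: normr_measurable.
apply: measurable_funS (@measurableT _ _) (@subsetT _ _) _.
apply: continuous_measurable_fun => x.
apply: differentiable_continuous; apply/derivable1_diffP.
have -> : (fun x : R => 2 * sin (x / 2)) = (fun x => 2 * sin (2^-1 * x)).
  by apply/funext => z; rewrite [z / 2]mulrC.
exact: (@ex_derive _ _ _ _ _ _ _ (is_derive_scale 2 (is_derive_sinM 2^-1 x))).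
Qed.

Lemma measurable_cos_sum N (c : R) (D : set R) : measurable D ->
  measurable_fun D (fun x : R => cos_sum N x + c).
Proof.
move=> mD; apply: measurable_funS (@measurableT _ _) (@subsetT _ _) _.
apply: continuous_measurable_fun => x.
apply: differentiable_continuous; apply/derivable1_diffP.
have dc : is_derive x 1 (fun z => cos_sum N z + c)
    (- \sum_(1 <= n < N.+1) sin (n%:R * x) + 0).
  by apply: is_derive_add; exact: is_derive_cos_sum.
exact: (@ex_derive _ _ _ _ _ _ _ dc).
Qed.

Lemma sin_sum_le2 N x : `|sin_sum N x| <= 2.
Proof.
have : `|sin_sum N x - sin_sum 0 x| <= 2 / 1 := sin_sum_cauchy x (leq0n N).
by rewrite {2}/sin_sum big_geq// subr0 divr1.
Qed.

(** Fatou's lemma for the nonnegative functions [cos_sum N x + 8], whose integrals over [[0, b]] are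
    at most [2 + 8 b]; the logarithmic singularities need no direct estimate. *)
Lemma integrable_ln_sin (b : R) : 0 < b ->
  mu.-integrable `[0%R, b] (fun x => (8 - ln `|2 * sin (x / 2)|)%:E).
Proof.
move=> b0; pose D := `[0%R, b]%classic : set R; have mD : measurable D by exact: measurable_itv.
pose g N x := (cos_sum N x + 8)%:E.
have mg N : measurable_fun D (g N) by apply/measurable_EFinP; exact: measurable_cos_sum.
have mh : measurable_fun D (fun x => (8 - ln `|2 * sin (x / 2)|)%:E).
  by apply/measurable_EFinP; apply: measurable_funB => //; exact: measurable_ln_sin.
have g0 N x : D x -> (0 <= g N x)%E.
  by move=> _; rewrite lee_fin; have := cos_sum_geN8 N x; move=> ?; lra.
have h0 x : D x -> (0 <= (8 - ln `|2 * sin (x / 2)|)%:E)%E.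
  by move=> _; rewrite lee_fin; have := ln_norm_sin_le (x / 2); move=> ?; lra.
have gf x : sin (x / 2) != 0 -> limn_einf (g^~ x) = (8 - ln `|2 * sin (x / 2)|)%:E.
  move=> s0; apply: (cvg_limn_einf_sup _).1; apply: cvg_EFin; first exact: nearW.
  by rewrite [8 - _]addrC; apply: cvgD; [exact: cvg_cos_sum|exact: cvg_cst].
have mlim : measurable_fun D (fun x => limn_einf (g^~ x)).
  rewrite (_ : (fun x => _) = -%E \o (fun x => limn_esup (fun N => (- g N x)%E))); last first.
    apply/funext => x; transitivity (- - limn_einf (g^~ x))%E; first by rewrite oppeK.
    by rewrite -limn_esupN.
  apply: measurableT_comp => //; apply: measurable_fun_limn_esup => // N.
  exact: measurableT_comp.
apply/integrableP; split => //.
have -> : (\int[mu]_(x in `[0%R, b]) `|(8 - ln `|2 * sin (x / 2)|)%:E|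
    = \int[mu]_(x in D) (8 - ln `|2 * sin (x / 2)|)%:E)%E.
  by apply: eq_integral => x; rewrite inE => xD; rewrite gee0_abs// h0.
have -> : (\int[mu]_(x in D) (8 - ln `|2 * sin (x / 2)|)%:E
    = \int[mu]_(x in D) limn_einf (g^~ x))%E.
  apply: ae_eq_integral => //; apply: (@ae_sin_half_neq0 b) => x s0 xD.
  by rewrite gf// s0//; move: xD; rewrite /D /= in_itv.
apply: le_lt_trans (fatou mu mD mg g0) _.
apply: (@le_lt_trans _ _ (2 + 8 * b)%:E); last by rewrite ltry.
(* The lower limit is the limit of the tail infima, each at most the first term of its tail. *)
rewrite limn_einf_lim; apply: lime_le; first exact: is_cvg_einfs.
apply: nearW => n; apply: (@le_trans _ _ (\int[mu]_(x in D) g n x)%E).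
  by apply: ereal_inf_lbound; exists n => //=.
rewrite integral_cos_sum// lee_fin lerD2r.
by apply: le_trans (sin_sum_le2 n b); exact: ler_norm.
Qed.

(** Dominated convergence for [cos_sum N], with the integrable majorant [8 - ln |2 sin (x / 2)|]
    from [cos_sum_estimate]. *)
Lemma cvg_sin_sum_Cl2 (b : R) : 0 <= b -> sin_sum N b @[N --> \oo] --> Cl2 b.
Proof.
rewrite le_eqVlt => /orP[/eqP <-|b0].
  rewrite /Cl2 lexx /Rintegral set_itv1 integral_set1 oppr0.
  by under eq_fun do rewrite sin_sum0; exact: cvg_cst.
pose D := `[0%R, b]%classic : set R; have mD : measurable D by exact: measurable_itv.
have [] := @dominated_convergence _ _ _ mu D mD (fun N x => (cos_sum N x + 0)%:E)
  (fun x => (- ln `|2 * sin (x / 2)|)%:E) (fun x => (8 - ln `|2 * sin (x / 2)|)%:E).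
- by move=> N; apply/measurable_EFinP; exact: measurable_cos_sum.
- by apply/measurable_EFinP; apply: measurableT_comp => //; exact: measurable_ln_sin.
- apply: (@ae_sin_half_neq0 b) => x s0 xD.
  apply: cvg_EFin; first exact: nearW.
  by under eq_fun do rewrite /= addr0; exact/cvg_cos_sum/s0.
- exact: integrable_ln_sin.
- apply: (@ae_sin_half_neq0 b) => x s0 N xD; rewrite addr0 lee_fin.
  by case: (cos_sum_estimate N (s0 xD)).
move=> intf _.
under eq_fun do rewrite integral_cos_sum// mul0r addr0.
have intN : mu.-integrable D (fun x => (ln `|2 * sin (x / 2)|)%:E).
  by have := integrableN intf; apply: eq_integrable => // x _ /=; rewrite opprK.
have -> : (\int[mu]_(x in D) (- ln `|2 * sin (x / 2)|)%:E = (Cl2 b)%:E)%E.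
  under eq_integral do rewrite EFinN.
  rewrite integralN ?integrable_add_def// /Cl2 (ltW b0) EFinN /Rintegral fineK//.
  exact: integrable_fin_num.
by move=> h; exact: (fine_cvg h).
Qed.

Lemma Cl2_sin_sum (b : R) N : 0 <= b ->
  `|Cl2 b - sin_sum N b| <= 2 / N.+1%:R.
Proof.
move=> /cvg_sin_sum_Cl2 h.
have h1 : `|sin_sum M b - sin_sum N b| @[M --> \oo] --> `|Cl2 b - sin_sum N b|.
  by apply: cvg_norm; apply: cvgB => //; exact: cvg_cst.
apply: (cvgr_to_le h1); near=> M; apply: sin_sum_cauchy.
by near: M; exact: nbhs_infty_ge.
Unshelve. all: by end_near. Qed.

(** * The sine product *)

(** Above by [y cos y <= sin y]; below by [sin y <= y] and [cos y >= 1 - y^2 / 2]. *)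
Lemma cot_sub_inv_le y : 0 < y <= pi / 2 -> `|cos y / sin y - y^-1| <= y / 2.
Proof.
move=> /andP[y0 ypi]; have pi0 := pi_gt0 R.
have s0 : 0 < sin y by apply: sin_gt0_pi; rewrite y0 /=; lra.
have c0 : 0 <= cos y by apply: cos_ge0_pihalf; apply/andP; split; lra.
have h1 : y * cos y <= sin y by apply: sin_ge_xcos; rewrite ltW//=; lra.
have h2 := sin_le_id (ltW y0); have h3 := cos_ge_quadratic (ltW y0).
have up : cos y / sin y <= y^-1.
  by rewrite ler_pdivrMr// mulrC -ler_pdivrMr ?invr_gt0// invrK mulrC.
have lo : y^-1 - y / 2 <= cos y / sin y.
  apply: (@le_trans _ _ (cos y / y)); last by rewrite ler_wpM2l// lef_pV2.
  by rewrite ler_pdivlMr// mulrBl mulVf ?gt_eqF//; lra.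
by rewrite ler_norml; apply/andP; split; lra.
Qed.

(** The sum equals [sin (m p) cot (p / 2) / 2 + (cos (m p) - 1) / 2]. For [p > 0], replacing
    [cot (p / 2)] by [2 / p] costs at most [p / 4 <= 1], hence 1/2 in the first term; the second is
    at most 1 in size. *)
Lemma sum_cos_approx m (p : R) : 0 < `|p| <= pi ->
  `|\sum_(1 <= j < m.+1) cos (j%:R * p) - sin (m%:R * p) / p| <= 3 / 2.
Proof.
(* Both the sum and [sin (m p) / p] are even in [p]. *)
wlog p0 : p / 0 < p => [hw|].
  case: (ltgtP p 0) => [p0|p0|->]; [|exact: hw|by rewrite normr0 ltxx].
  rewrite -normrN => hp; have := hw (- p); rewrite oppr_gt0 => /(_ p0 hp).
  rewrite mulrN sinN invrN mulrNN.
  by under eq_bigr do rewrite mulrN cosN.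
rewrite gtr0_norm// => /andP[_ ppi]; have pi0 := pi_gt0 R; have pi4 : pi <= 4 :> R by exact: pi_le4.
have s0 : 0 < sin (p / 2) by apply: sin_half_gt0; rewrite p0.
have : `|cos (p / 2) / sin (p / 2) - (p / 2)^-1| <= p / 2 / 2.
  by apply: cot_sub_inv_le; apply/andP; split; lra.
have := sum_cos_mul p m; set S := \sum_(_ <= _ < _) _ => SE.
have {SE} -> : S = sin (m%:R * p) * (cos (p / 2) / sin (p / 2)) / 2 + (cos (m%:R * p) - 1) / 2.
  have -> : S = 2 * sin (p / 2) * S / (2 * sin (p / 2)) by field; lra.
  by rewrite SE; field; lra.
set q := cos _ / sin _; have -> : (p / 2)^-1 = 2 * p^-1 by field; lra.
move=> hq.
have -> : sin (m%:R * p) * q / 2 + (cos (m%:R * p) - 1) / 2 - sin (m%:R * p) / p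
   = sin (m%:R * p) * ((q - 2 * p^-1) / 2) + (cos (m%:R * p) - 1) / 2 by field; lra.
apply: le_trans (ler_normD _ _) _; rewrite normrM.
have h1 : `|sin (m%:R * p)| * `|(q - 2 * p^-1) / 2| <= 1 / 2.
  apply: (@le_trans _ _ `|(q - 2 * p^-1) / 2|); first by rewrite ler_piMl// sin_max.
  rewrite normrM normfV [`|2|]ger0_norm// ler_pM2r ?invr_gt0//.
  by apply: le_trans hq _; lra.
have h2 : `|(cos (m%:R * p) - 1) / 2| <= 1.
  have := cos_geN1 (m%:R * p); have := cos_le1 (m%:R * p) => ? ?.
  by rewrite ler_norml; apply/andP; split; lra.
lra.
Qed.

Lemma cosD2pi_int x (z : int) : cos (x + 2 * pi * z%:~R) = cos x.
Proof.
have nat_case y n : cos (y + 2 * pi * n%:R) = cos y.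
  by have := periodicn (@cosD2pi R) n y; rewrite -[pi *+ 2 *+ n]mulr_natr -[pi *+ 2]mulr_natl.
case: z => n; first exact: nat_case.
rewrite NegzE mulrNz mulrN -[LHS](nat_case _ n.+1); congr cos.
by rewrite -addrA [X in _ + X]addrC pmulrn subrr addr0.
Qed.

End CosineSeries.

(** * Residues of [n h] modulo [k] of least absolute value *)

Section SignedResidue.
Variables (h k : nat).
Hypotheses (k_gt1 : (1 < k)%N) (co_hk : coprime h k).
Implicit Types n j : nat.

Definition res n := ((n * h) %% k)%N.

Definition sres n : int := if (2 * res n <= k)%N then (res n)%:Z else (res n)%:Z - k%:Z.

Lemma res_lt n : (res n < k)%N.
Proof. by rewrite ltn_mod (ltn_trans _ k_gt1). Qed.

Lemma res_inj n j : (n < k)%N -> (j < k)%N -> res n = res j -> n = j.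
Proof.
wlog nj : n j / (n <= j)%N => [hw|] nk jk.
  by case: (leqP n j) => [|/ltnW] le_nj e; [|apply/esym]; apply: hw.
move=> /esym/eqP; rewrite eqn_mod_dvd ?leq_mul2r ?nj ?orbT// -mulnBl.
rewrite Gauss_dvdl; last by rewrite coprime_sym.
move=> /dvdn_leq; case: (posnP (j - n)) => [/eqP|jn0 /(_ isT)].
  by rewrite subn_eq0 => jn _; apply/eqP; rewrite eqn_leq nj jn.
by lia.
Qed.

Lemma res_gt0 n : (0 < n < k)%N -> (0 < res n)%N.
Proof.
move=> /andP[n0 nk]; rewrite lt0n; apply/eqP => r0.
have : n = 0%N by apply: res_inj => //; [lia|rewrite r0 /res mul0n mod0n].
lia.
Qed.

Lemma sres_mod n : exists t : int, sres n = n%:Z * h%:Z - t * k%:Z.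
Proof.
have E := divn_eq (n * h) k; rewrite /sres -/(res n) in E *.
case: ifP => _; [exists ((n * h) %/ k)%N%:Z|exists ((n * h) %/ k)%N.+1%:Z]; lia.
Qed.

(** Two representatives differ by a multiple of [k]. The strict bound on [g] rules out the tie at
    [k / 2] and makes the difference smaller than [k]. *)
Lemma sres_unique n (g : int) (t : int) : g = n%:Z * h%:Z - t * k%:Z ->
  2 * `|g| < k%:Z -> sres n = g.
Proof.
move=> gE g2; have [t' sE] := sres_mod n.
have s2 : 2 * `|sres n| <= k%:Z.
  rewrite /sres; have := res_lt n; case: ifP; lia.
have : (t - t') * k%:Z = sres n - g by rewrite sE gE; ring.
case: (t - t' =P 0) => [->|]; first by lia.
nia.
Qed.

Lemma sres_le n : 2 * `|sres n| <= k%:Z.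
Proof. by rewrite /sres; have := res_lt n; case: ifP; lia. Qed.

Lemma sres_neq0 n : (0 < n < k)%N -> sres n != 0.
Proof. by move=> /res_gt0; have := res_lt n; rewrite /sres; case: ifP; lia. Qed.

(** As [h] is coprime to [k], multiplication by [h] permutes the nonzero residues. *)
Lemma big_res (R : nmodType) (F : nat -> R) :
  \sum_(1 <= n < k) F (res n) = \sum_(1 <= n < k) F n.
Proof.
rewrite -(big_map res xpredT F); apply: perm_big.
have um : uniq (map res (index_iota 1 k)).
  rewrite map_inj_in_uniq ?iota_uniq// => n j; rewrite !mem_index_iota.
  by move=> /andP[_ nk] /andP[_ jk]; exact: res_inj.
have sub : {subset map res (index_iota 1 k) <= index_iota 1 k}.
  move=> r /mapP[n]; rewrite !mem_index_iota => n1 ->.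
  by rewrite res_gt0// res_lt.
apply: uniq_perm => //; first exact: iota_uniq.
by apply: (uniq_min_size um sub _).2; rewrite size_map.
Qed.

(** [|sres n|] is [res n] or [k - res n]. Bounding its inverse by the sum of both inverses and
    permuting the residues leaves two harmonic sums. *)
Lemma sum_inv_sres (R : realType) :
  \sum_(1 <= n < k) `|sres n|%:~R^-1 <= 2 * (1 + ln k%:R) :> R.
Proof.
have hk : harmonic_sum R k <= 1 + ln k%:R by apply: harmonic_sum_lt; exact: ltnW.
apply: (@le_trans _ _ (\sum_(1 <= n < k) (((res n)%:R : R)^-1 + (k - res n)%:R^-1))).
  apply: ler_sum_nat => n /res_gt0 r0; have rk := res_lt n.
  rewrite /sres; case: ifP => _.
    by rewrite -[`|_|%:~R]/((res n)%:R) lerDl invr_ge0.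
  rewrite (_ : `|_| = (k - res n)%:Z); last by lia.
  by rewrite -[(_%:Z)%:~R]/((k - res n)%:R) lerDr invr_ge0.
rewrite (big_res (fun r => (r%:R^-1 : R) + (k - r)%:R^-1)) big_split /=.
rewrite [X in _ + X]big_nat_rev /= [X in _ + X](_ : _ = harmonic_sum R k); last first.
  apply: eq_big_nat => n /andP[n1 nk]; congr (_%:R^-1); lia.
by rewrite -/(harmonic_sum R k); lra.
Qed.

End SignedResidue.

(** * From the sine product to a sum over residues *)

Section SineProduct.
Variables (R : realType) (h k : nat).
Hypotheses (k_gt1 : (1 < k)%N) (co_hk : coprime h k).
Implicit Types n j m : nat.

Local Notation sres := (sres h k).

Let k_gt0 : 0 < k%:R :> R. Proof. by rewrite ltr0n (ltn_trans _ k_gt1). Qed.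

(** The angle [2 pi n h / k] reduced modulo [2 pi] to [[-pi, pi]], the range in which
    [sum_cos_approx] works. *)
Definition ang n : R := 2 * pi * (sres n)%:~R / k%:R.

Lemma cos_ang n j : cos (j%:R * (2 * pi * n%:R * (h%:R / k%:R))) = cos (j%:R * ang n).
Proof.
have [t tE] : exists t : int, sres n = n%:Z * h%:Z - t * k%:Z by exact: sres_mod.
rewrite /ang tE.
rewrite -[RHS](cosD2pi_int _ (j%:Z * t)); congr cos.
rewrite rmorphB !rmorphM /= -!pmulrn; field; exact: lt0r_neq0.
Qed.

Lemma norm_ang n : `|ang n| = 2 * pi * `|sres n|%:~R / k%:R.
Proof.
rewrite /ang !normrM normfV [`|2|]ger0_norm// [`|pi|]ger0_norm ?pi_ge0//.
by rewrite [`|k%:R|]ger0_norm// -intr_norm.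
Qed.

Lemma norm_ang_bounds n : (0 < n < k)%N -> 0 < `|ang n| <= pi.
Proof.
move=> nk; have pi0 := pi_gt0 R; rewrite norm_ang; apply/andP; split.
  rewrite divr_gt0// mulr_gt0// ?mulr_gt0// ltr0z normr_gt0.
  exact: (sres_neq0 k_gt1 co_hk).
rewrite ler_pdivrMr// [2 * pi]mulrC -mulrA ler_pM2l//.
have : 2 * `|sres n| <= k%:Z by exact: sres_le.
rewrite -(ler_int R) rmorphM /=.
by rewrite -!pmulrn.
Qed.

(** [|sin (pi n h / k)|] equals [|sin (|ang n| / 2)|], to which Jordan's inequality applies. *)
Lemma sin_ang_ge n : (0 < n < k)%N ->
  2 * `|sres n|%:~R / k%:R <= `|sin (pi * n%:R * (h%:R / k%:R))| :> R.
Proof.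
move=> nk; have pi0 := pi_gt0 R; have /andP[a0 api] := norm_ang_bounds nk.
have cE : cos (2 * pi * n%:R * (h%:R / k%:R)) = cos `|ang n|.
  by have := cos_ang n 1; rewrite !mul1r cos_norm.
have := norm_sin_half_eq cE.
have -> : 2 * pi * n%:R * (h%:R / k%:R) / 2 = pi * n%:R * (h%:R / k%:R) :> R.
  by field; exact: lt0r_neq0.
move=> ->; apply: le_trans (ler_norm _).
have -> : 2 * `|sres n|%:~R / k%:R = 2 / pi * (`|ang n| / 2) :> R.
  rewrite norm_ang; move: (@pi R) pi0 => p p0.
  by field; rewrite (lt0r_neq0 p0) (lt0r_neq0 k_gt0).
by apply: sin_ge_jordan; apply/andP; split; lra.
Qed.

Lemma sin_ang_neq0 n : (0 < n < k)%N -> sin (pi * n%:R * (h%:R / k%:R)) != 0 :> R.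
Proof.
move=> nk; rewrite -normr_gt0; apply: lt_le_trans (sin_ang_ge nk).
rewrite divr_gt0// mulr_gt0// ltr0z normr_gt0; exact: (sres_neq0 k_gt1 co_hk).
Qed.

Lemma ln_inv_sinprod m : (m < k)%N ->
  ln `|1 / sinprod m (h%:R / k%:R : R)|
  = - \sum_(1 <= j < m.+1) ln `|2 * sin (pi * j%:R * (h%:R / k%:R))|.
Proof.
move=> mk.
(* Positivity goes through the induction along with the formula, since [ln] turns products of
   positive factors into sums. *)
suff [] : 0 < `|sinprod m (h%:R / k%:R : R)| /\
    ln `|sinprod m (h%:R / k%:R : R)|
      = \sum_(1 <= j < m.+1) ln `|2 * sin (pi * j%:R * (h%:R / k%:R))|.
  by move=> p0 <-; rewrite div1r normfV lnV.
elim: m mk => [|m IH] mk.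
  by rewrite /sinprod !big_geq// normr1 ln1.
have [p0 IHE] := IH (ltnW mk).
have s0 : 0 < `|2 * sin (pi * m.+1%:R * (h%:R / k%:R : R))|.
  by rewrite normr_gt0 mulf_neq0 ?pnatr_eq0// sin_ang_neq0.
have E : sinprod m.+1 (h%:R / k%:R : R)
    = sinprod m (h%:R / k%:R) * (2 * sin (pi * m.+1%:R * (h%:R / k%:R))).
  by rewrite /sinprod big_nat_recr.
by rewrite E normrM mulr_gt0// lnM// IHE [in RHS]big_nat_recr.
Qed.

Lemma ln_sinprod_approx m : (m < k)%N ->
  `|k%:R^-1 * ln `|1 / sinprod m (h%:R / k%:R : R)|
    - (2 * pi)^-1 * \sum_(1 <= n < k) sin (m%:R * ang n) / (n%:R * (sres n)%:~R)|
  <= (11 / 2 + 7 / 2 * ln k%:R) / k%:R.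
Proof.
move=> mk; have pi0 := pi_gt0 R.
have kE : k.-1.+1 = k by rewrite prednK// (ltn_trans _ k_gt1).
rewrite ln_inv_sinprod//.
pose x j : R := 2 * pi * j%:R * (h%:R / k%:R).
have xE j : pi * j%:R * (h%:R / k%:R) = x j / 2 :> R.
  by rewrite /x; field; exact: lt0r_neq0.
(* The error of cutting the Fourier series at [n < k]. By Jordan's inequality its main part is at
   most [1 / |sres j|]. *)
pose e1 j : R := ln `|2 * sin (x j / 2)| + cos_sum k.-1 (x j).
have e1_le j : (0 < j < k)%N -> `|e1 j| <= `|sres j|%:~R^-1 + 2 / k%:R.
  move=> jk; have s0 := sin_ang_neq0 jk; rewrite xE in s0.
  apply: le_trans (cos_sum_bound _ s0) _; rewrite kE lerD2r.
  apply: le_trans (inv_half_shift_le _ _) _; first by rewrite normr_gt0.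
  rewrite kE; have := sin_ang_ge jk; rewrite xE => sge.
  have a0 : 0 < `|sres j|%:~R :> R.
    by rewrite ltr0z normr_gt0; exact: (sres_neq0 k_gt1 co_hk).
  have {}sge : `|sin (x j / 2)|^-1 <= k%:R / (2 * `|sres j|%:~R).
    rewrite -[leRHS]invf_div lef_pV2 ?posrE ?normr_gt0// divr_gt0// mulr_gt0//.
  rewrite ler_pdivrMr//; apply: le_trans (ler_wpM2l _ sge) _ => //.
  by rewrite le_eqVlt; apply/orP; left; apply/eqP; field; exact: lt0r_neq0.
pose e2 n : R := \sum_(1 <= j < m.+1) cos (j%:R * ang n) - sin (m%:R * ang n) / ang n.
have e2_le n : (0 < n < k)%N -> `|e2 n| <= 3 / 2.
  by move=> nk; apply: sum_cos_approx; exact: norm_ang_bounds.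
(* The sums are exchanged by the symmetry of [n j h / k]: the angles [n x_j] and [j ang n] have the
   same cosine. *)
have S1 : \sum_(1 <= j < m.+1) cos_sum k.-1 (x j)
    = \sum_(1 <= n < k) (sin (m%:R * ang n) / ang n + e2 n) / n%:R.
  rewrite /cos_sum exchange_big /= kE; apply: eq_big_nat => n _.
  rewrite /e2 addrCA subrr addr0 mulr_suml; apply: eq_bigr => j _; congr (_ / _).
  by rewrite -cos_ang /x; congr cos; ring.
have -> : - \sum_(1 <= j < m.+1) ln `|2 * sin (pi * j%:R * (h%:R / k%:R))|
   = \sum_(1 <= n < k) sin (m%:R * ang n) / ang n / n%:R
     + \sum_(1 <= n < k) e2 n / n%:R - \sum_(1 <= j < m.+1) e1 j.
  rewrite -big_split /=; under [X in _ = X - _]eq_bigr do rewrite -mulrDl.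
  rewrite -S1 -sumrB -sumrN; apply: eq_bigr => j _.
  by rewrite /e1 xE opprD addrCA subrr addr0.
have -> : (2 * pi)^-1 * \sum_(1 <= n < k) sin (m%:R * ang n) / (n%:R * (sres n)%:~R)
   = k%:R^-1 * \sum_(1 <= n < k) sin (m%:R * ang n) / ang n / n%:R.
  rewrite !mulr_sumr; apply: eq_big_nat => n nk; rewrite /ang.
  move: (@pi R) pi0 => p p0; field.
  rewrite (lt0r_neq0 p0) (lt0r_neq0 k_gt0) intr_eq0 (sres_neq0 k_gt1 co_hk nk).
  by rewrite pnatr_eq0 -lt0n; case/andP : nk => ->.
rewrite -mulrBr [X in `|_ * X|](_ : _ =
  \sum_(1 <= n < k) e2 n / n%:R - \sum_(1 <= j < m.+1) e1 j); last by ring.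
rewrite normrM gtr0_norm ?invr_gt0// mulrC ler_pM2r ?invr_gt0//.
apply: le_trans (ler_normB _ _) _.
have hk : harmonic_sum R k <= 1 + ln k%:R by apply: harmonic_sum_lt; exact: ltnW.
have b2 : `|\sum_(1 <= n < k) e2 n / n%:R| <= 3 / 2 * (1 + ln k%:R).
  apply: le_trans (ler_norm_sum _ _ _) _.
  apply: (@le_trans _ _ (3 / 2 * harmonic_sum R k)); last by rewrite ler_wpM2l.
  rewrite /harmonic_sum mulr_sumr; apply: ler_sum_nat => n nk.
  by rewrite normrM normfV [`|n%:R|]ger0_norm// ler_wpM2r// e2_le.
(* The range [j <= m] is enlarged to [j < k], where [sum_inv_sres] applies. Together with [b2] this
   makes [11/2 + (7/2) ln k]. *)
have b1 : `|\sum_(1 <= j < m.+1) e1 j| <= 2 * (1 + ln k%:R) + 2.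
  apply: le_trans (ler_norm_sum _ _ _) _.
  apply: (@le_trans _ _ (\sum_(1 <= j < k) (`|sres j|%:~R^-1 + 2 / k%:R))).
    rewrite [leRHS](@big_cat_nat _ _ _ m.+1)//= -[leLHS]addr0 lerD//.
      by apply: ler_sum_nat => j /andP[j0 jm]; apply: e1_le; rewrite j0 (leq_trans jm).
    by apply: sumr_ge0 => j _; rewrite addr_ge0// ?invr_ge0 ?ler0z// divr_ge0.
  rewrite big_split /= lerD//; first exact: (sum_inv_sres k_gt1 co_hk).
  rewrite sumr_const_nat -[leLHS]mulr_natr -mulrA ler_piMr// ler_pdivrMl// mulr1 ler_nat.
  by rewrite leq_subr.
lra.
Qed.

End SineProduct.

(** * Lattice points *)

Section ResidueLattice.
Variables (h k : nat).

Definition lat (n : nat) (g : int) := exists t : int, g = n%:Z * h%:Z - t * k%:Z.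

(** Euclidean division [n = d b + r]: if [r > 0], the vector [(r, g - d g0)] is in the lattice,
    parallel to [(b, g0)] and shorter, which the last hypothesis forbids. That hypothesis stays
    abstract because two kinds of minimality supply it: of the product [b |g|], and of the first
    coordinate inside a box. *)
Lemma lat_multiple (b n : nat) (g0 g : int) :
    lat b g0 -> lat n g -> (0 < b)%N -> g0 != 0 -> n%:Z * g0 = b%:Z * g ->
    (forall (r : nat) (g' : int), lat r g' -> (0 < r < b)%N -> g' != 0 ->
       `|g'| < `|g0| -> r%:Z * g0 = b%:Z * g' -> False) ->
  exists d : nat, n = (d * b)%N /\ g = d%:Z * g0.
Proof.
move=> [t0 t0E] [t tE] b0 g00 col irr; exists (n %/ b)%N.
have E := divn_eq n b; have rb : (n %% b < b)%N by rewrite ltn_mod.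
move: E rb; set d := (n %/ b)%N; set r := (n %% b)%N => E rb.
have Ez : n%:Z = d%:Z * b%:Z + r%:Z by lia.
have col' : r%:Z * g0 = b%:Z * (g - d%:Z * g0) by rewrite mulrBr -col Ez; ring.
have b0z : (b%:Z != 0) by lia.
case: (posnP r) => [r0|r0].
  split; first by lia.
  move: col'; rewrite r0 mul0r => /esym/eqP; rewrite mulf_eq0 (negbTE b0z) /=.
  by rewrite subr_eq0 => /eqP.
exfalso; apply: (irr r (g - d%:Z * g0)) => //.
- exists (t - d%:Z * t0); rewrite {1}tE {1}t0E Ez; ring.
- by rewrite r0.
- apply/eqP => e; move: col'; rewrite e mulr0 => /eqP.
  by rewrite mulf_eq0 (negbTE g00) orbF; lia.
- have : `|r%:Z * g0| = `|b%:Z * (g - d%:Z * g0)| by rewrite col'.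
  rewrite !normrM; have : 0 < `|g0| by rewrite normr_gt0.
  move: `|g0| `|g - _| => u v u0; rewrite !ger0_norm//; nia.
Qed.

Lemma lat_det (n n' : nat) (g g' : int) : lat n g -> lat n' g' ->
  `|n%:Z * g' - n'%:Z * g| < k%:Z -> n%:Z * g' = n'%:Z * g.
Proof.
move=> [t ->] [t' ->].
have -> : n%:Z * (n'%:Z * h%:Z - t' * k%:Z) - n'%:Z * (n%:Z * h%:Z - t * k%:Z)
  = (n'%:Z * t - n%:Z * t') * k%:Z by ring.
rewrite normrM => lt_k; apply/eqP; rewrite -subr_eq0.
have -> : n%:Z * (n'%:Z * h%:Z - t' * k%:Z) - n'%:Z * (n%:Z * h%:Z - t * k%:Z)
  = (n'%:Z * t - n%:Z * t') * k%:Z by ring.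
suff -> : n'%:Z * t - n%:Z * t' = 0 by rewrite mul0r.
apply/eqP; apply: contraTT lt_k => z0; rewrite -leNgt.
have : 1 <= `|n'%:Z * t - n%:Z * t'| by rewrite -gtz0_ge1 normr_gt0.
by move: `|_ - _| => u u1; rewrite ger0_norm//; nia.
Qed.

Hypotheses (k_gt1 : (1 < k)%N) (co_hk : coprime h k).

Lemma sres_lat n : lat n (sres h k n).
Proof. exact: sres_mod. Qed.

(* [(b, g)] stands for [(beta0, gamma0)], both signs being flipped if
   [beta0 < 0]. *)
Definition lat_min (b : nat) (g : int) :=
  [/\ (0 < b < k)%N, g != 0, lat b g &
      forall (n : nat) (s : int), (0 < n < k)%N -> s != 0 -> `|s| < k%:Z ->
        lat n s -> b%:Z * `|g| <= n%:Z * `|s| ].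

Lemma Zmin_lat_min (beta0 gamma0 : int) : Zmin h k (beta0, gamma0) ->
  exists (b : nat) (g : int),
    [/\ lat_min b g, `|g| = gamma0 & `|beta0 * gamma0| = b%:Z * `|g| ].
Proof.
move=> [[/= bk gk modk] minq]; exists `|beta0|%N, (Num.sg beta0 * gamma0).
have [t tE] : exists t : int, gamma0 = beta0 * h%:Z - t * k%:Z.
  move/eqP : modk; rewrite eqz_mod_dvd => /dvdzP[t tE]; exists t; rewrite -tE; ring.
have absE : `|beta0|%N%:Z = `|beta0| by rewrite abszE.
have b0 : beta0 != 0 by lia.
have gE : `|Num.sg beta0 * gamma0| = gamma0.
  by rewrite normrM normr_sg b0 mul1r ger0_norm//; lia.
split; last by rewrite gE absE normrM [`|gamma0|]ger0_norm//; lia.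
- split.
  + lia.
  + by rewrite mulf_neq0 ?sgr_eq0//; lia.
  + exists (Num.sg beta0 * t); rewrite absE normrEsg {1}tE; ring.
  + move=> n s nk s0 sk [t' sE].
    (* A competitor with [s < 0] enters [Z(h, k)], where second entries are positive, after both its
       signs are flipped. *)
    have := minq (Num.sg s * n%:Z, `|s|).
    rewrite /= !normrM normr_id normr_sg s0 mul1r.
    rewrite [`|n%:Z|]ger0_norm// absE -[`|beta0| * `|gamma0|]normrM => h1.
    rewrite normr_sg b0 mul1r -normrM; apply: h1.
    rewrite /Zset /= normrM normr_sg s0 mul1r ger0_norm//; split.
    * lia.
    * by rewrite sk andbT -gtz0_ge1 normr_gt0.
    * apply/eqP; rewrite eqz_mod_dvd; apply/dvdzP; exists (Num.sg s * t').
      have -> : `|s| = Num.sg s * (n%:Z * h%:Z - t' * k%:Z) by rewrite -sE normrEsg.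
      by ring.
- by [].
Qed.

End ResidueLattice.

(** * Sums over multiples and truncated harmonic sums *)

Lemma big_multiples (R : nmodType) (P : pred nat) (F : nat -> R) (b k : nat) :
    (0 < b)%N -> (forall n, (0 < n < k)%N -> P n -> (b %| n)%N) ->
  \sum_(1 <= n < k | P n) F n
  = \sum_(1 <= d < k | P (d * b)%N && (d * b < k)%N) F (d * b)%N.
Proof.
move=> b0 Pb; rewrite -big_filter -[RHS]big_filter -[RHS](big_map (muln^~ b) xpredT F).
apply: perm_big; apply: uniq_perm.
- by rewrite filter_uniq// iota_uniq.
- rewrite map_inj_uniq ?filter_uniq ?iota_uniq// => x y /eqP.
  by rewrite eqn_pmul2r// => /eqP.
move=> n; rewrite mem_filter mem_index_iota; apply/andP/mapP => [[Pn nk]|[d]].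
  have /dvdnP[d dE] := Pb n nk Pn; exists d => //.
  rewrite mem_filter mem_index_iota -dE Pn /=; move: nk; rewrite dE => /andP[d0 dk].
  rewrite dk /=; apply/andP; split; first by move: d0; case: (d).
  by apply: leq_ltn_trans dk; rewrite leq_pmulr.
rewrite mem_filter mem_index_iota => /andP[/andP[Pd dk] /andP[d0 _]] ->.
by rewrite Pd dk muln_gt0 d0 b0.
Qed.

Section HarmonicCut.
Variable R : realType.

Lemma harmonic_cut (K : nat) (X : R) : 1 <= X ->
  \sum_(1 <= n < K | n%:R <= X) n%:R^-1 <= 1 + ln X.
Proof.
move=> X1; have X0 : 0 <= 1 + ln X by rewrite addr_ge0// ln_ge0.
elim: K => [|[|K] IH]; [by rewrite big_geq|by rewrite big_geq|].
rewrite big_mkcond big_nat_recr//= -big_mkcond /=.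
case: ifPn => KX; last by rewrite addr0.
apply: (@le_trans _ _ (1 + ln K.+1%:R)); last first.
  by rewrite lerD2l ler_ln ?posrE ?ltr0n// (lt_le_trans ltr01 X1).
apply: le_trans (harmonic_sum_le R (ltn0Sn K)).
rewrite harmonic_sumS// lerD2r /harmonic_sum [leLHS]big_mkcond /=.
by apply: ler_sum => n _; case: ifP => // _; rewrite invr_ge0.
Qed.

End HarmonicCut.

(** * The sum over the lattice points [(n, sres n)] *)

Section LatticeSum.
Variables (R : realType) (h k : nat).
Hypotheses (k_gt1 : (1 < k)%N) (co_hk : coprime h k).
Variables (b : nat) (g : int).
Hypothesis bg_min : lat_min h k b g.
Implicit Types n m d : nat.

Local Notation sres := (sres h k).
Local Notation lat := (lat h k).

Let k_gt0 : 0 < k%:R :> R. Proof. by rewrite ltr0n (ltn_trans _ k_gt1). Qed.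

Let sres_neq0 n : (0 < n < k)%N -> sres n != 0. Proof. exact: sres_neq0. Qed.

Let sres_le n : 2 * `|sres n| <= k%:Z. Proof. exact: sres_le. Qed.

Let sres_lat n : lat n (sres n). Proof. exact: sres_lat. Qed.

Let sres_lt n : `|sres n| < k%:Z.
Proof. by have := sres_le n; lia. Qed.

Let sres_lat_unique n (s : int) : lat n s -> 2 * `|s| < k%:Z -> sres n = s.
Proof. by move=> [t tE] s2; apply: sres_unique tE s2. Qed.

Definition collinear n := n%:Z * g == b%:Z * sres n.

Lemma collinear_multiple n : (0 < n < k)%N -> collinear n ->
  exists d, n = (d * b)%N /\ sres n = d%:Z * g.
Proof.
have [/andP[b0 bk] g0 latb minb] := bg_min.
move=> nk /eqP col; apply: (lat_multiple latb (sres_lat n) b0 g0 col).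
move=> r s lats /andP[r0 rb] s0 sg _.
(* Comparing [(b, g)] with the lattice point [(b, sres b)] gives [|g| <= |sres b| < k]. *)
have gk : `|g| < k%:Z.
  have := minb b (sres b); rewrite b0 bk => /(_ isT (sres_neq0 _) (sres_lt b) (sres_lat b)).
  by rewrite b0 bk => /(_ isT); have := sres_lt b; nia.
have := minb r s; rewrite r0 (ltn_trans rb bk) => /(_ isT s0 (lt_trans sg gk) lats).
nia.
Qed.

(** Put [X = n |g|] and [Y = b |sres n|]. The nonzero determinant gives [k <= X + Y], and
    [X + Y <= 1 + X Y] since both are at least 1. By minimality [X Y = (n |sres n|) (b |g|) <= (n
    |sres n|)^2], which is at least 1. *)
Lemma noncollinear_ge n : (0 < n < k)%N -> ~~ collinear n ->
  k%:Z <= 2 * (n%:Z * `|sres n|) ^+ 2.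
Proof.
have [/andP[b0 bk] g0 latb minb] := bg_min.
move=> nk ncol.
have := minb n (sres n) nk (sres_neq0 nk) (sres_lt n) (sres_lat n).
have : ~~ (`|n%:Z * g - b%:Z * sres n| < k%:Z).
  apply: contra ncol => lt_k; apply/eqP.
  exact: lat_det (sres_lat n) latb lt_k.
rewrite -leNgt => det.
have {det} : k%:Z <= n%:Z * `|g| + b%:Z * `|sres n|.
  apply: le_trans det _; apply: le_trans (ler_normB _ _) _.
  by rewrite !normrM [`|n%:Z|]ger0_norm// [`|b%:Z|]ger0_norm.
have : 1 <= `|g| by rewrite -gtz0_ge1 normr_gt0.
have : 1 <= `|sres n| by rewrite -gtz0_ge1 normr_gt0 sres_neq0.
have : 1 <= n%:Z by lia.
have : 1 <= b%:Z by lia.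
move: `|g| `|sres n| n%:Z b%:Z => u v x y y1 x1 v1 u1 hk hm.
have h1 : 0 <= (x * u - 1) * (y * v - 1) by rewrite mulr_ge0//; nia.
have h2 : (x * u) * (y * v) <= (x * v) ^+ 2.
  rewrite (_ : x * u * (y * v) = (x * v) * (y * u)); last by ring.
  by rewrite expr2 ler_wpM2l//; nia.
have h3 : 1 <= (x * v) ^+ 2 by nia.
nia.
Qed.

(** The box [n < sqrt (2 k)], [|s| < sqrt (k / 8)]. Its sides multiply to [k / 2], so both products
    in a determinant of two box vectors are below [k / 2] and the determinant vanishes. *)
Let small n := (n%:Z ^+ 2 < 2 * k%:Z) && (8 * sres n ^+ 2 < k%:Z).

Lemma small_det n n' : small n -> small n' -> n%:Z * sres n' = n'%:Z * sres n.
Proof.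
move=> /andP[n1 s1] /andP[n2 s2]; apply: lat_det => //.
have cross (x y : int) : x ^+ 2 < 2 * k%:Z -> 8 * y ^+ 2 < k%:Z -> 2 * `|x * y| < k%:Z.
  move=> hx hy; rewrite -(@ltr_pXn2r _ 2)// ?nnegrE ?mulr_ge0//.
  rewrite exprMn real_normK ?num_real// exprMn.
  by move: (x ^+ 2) (y ^+ 2) (sqr_ge0 x) (sqr_ge0 y) hx hy => u v u0 v0 hx hy; nia.
have := cross _ _ n1 s2; have := cross _ _ n2 s1.
have := ler_normB (n%:Z * sres n') (n'%:Z * sres n); lia.
Qed.

(** Let [a] be the least index in the sum. The others are multiples [d a] with residue [d (sres a)],
    so the sum is at most [q] times the sum of [1 / d^2]. *)
Lemma small_sum (q : R) : 0 <= q ->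
    (forall n, (0 < n < k)%N -> ~~ collinear n -> (n%:R * `|sres n|%:~R)^-1 <= q) ->
  \sum_(1 <= n < k | ~~ collinear n && small n) (n%:R * `|sres n|%:~R : R)^-1 <= 2 * q.
Proof.
move=> q0 leq_q.
pose A n := [&& (0 < n < k)%N, ~~ collinear n & small n].
have [[n An]|nA] := pselect (exists n, A n); last first.
  rewrite big_nat_cond big_pred0 ?mulr_ge0// => n.
  by apply/negP => Pn; apply: nA; exists n.
case: (ex_minnP (ex_intro _ n An)) => a /and3P[a0k ncola sma] mina {n An}.
have /andP[a0 ak] := a0k.
have mult n : A n -> exists d, n = (d * a)%N /\ sres n = d%:Z * sres a.
  move=> /and3P[n0k ncoln smn].
  apply: (lat_multiple (sres_lat a) (sres_lat n) a0 (sres_neq0 a0k)).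
    by apply/esym; exact: small_det.
  (* A shorter parallel vector [(r, s)] would also be small and not parallel to [(b, g)], against
     the choice of [a]. *)
  move=> r s lats /andP[r0 ra] s0 sa col.
  have sE : sres r = s by apply: sres_lat_unique => //; have := sres_le a; lia.
  suff /mina : A r by rewrite leqNgt ra.
  apply/and3P; split; first by rewrite r0 (ltn_trans ra).
    apply: contra ncola; rewrite /collinear sE => /eqP colr; apply/eqP.
    have r0z : r%:Z != 0 by lia.
    apply: (mulfI r0z); rewrite mulrCA colr mulrCA -col; ring.
  rewrite /small sE; case/andP : sma => h1 h2; apply/andP; split.
    by apply: le_lt_trans h1; rewrite ler_pXn2r ?nnegrE//; lia.
  apply: le_lt_trans h2; rewrite ler_pM2l// -[s ^+ 2]real_normK ?num_real//.
  rewrite -[sres a ^+ 2]real_normK ?num_real//.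
  by rewrite ler_pXn2r ?nnegrE// ltW.
rewrite (@big_multiples _ _ _ a)//; last first.
  move=> n n0k /andP[ncol sm]; have [|d [-> _]] := mult n; last exact: dvdn_mull.
  by rewrite /A n0k ncol.
apply: (@le_trans _ _ (\sum_(1 <= d < k) q * d%:R ^- 2)); last first.
  rewrite -mulr_sumr mulrC ler_wpM2r//.
  by apply: le_trans (sum_inv_sqr_le R k (ltn0Sn 0)) _; rewrite divr1.
rewrite big_mkcond /=; apply: ler_sum_nat => d /andP[d0 dk].
case: ifP => [/andP[/andP[ncol sm] dak]|_]; last first.
  by rewrite mulr_ge0// invr_ge0 sqr_ge0.
have [|d' [/eqP]] := mult (d * a)%N.
  by rewrite /A ncol sm muln_gt0 d0 a0 dak.
rewrite eqn_pmul2r// => /eqP <- ->.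
rewrite normrM [`|d%:Z|]ger0_norm// natrM intrM -pmulrn.
rewrite (_ : _ * _ = d%:R ^+ 2 * (a%:R * `|sres a|%:~R)); last by ring.
by rewrite invfM mulrC ler_wpM2r ?invr_ge0 ?sqr_ge0// leq_q.
Qed.

(** Let [q = sqrt (2 / k)]. A term is at most [(q / 2) / |sres n|] if [n >= sqrt (2 k)], and at most
    [2 q / n] if [|sres n| >= sqrt (k / 8)]; the remaining terms lie in the box. The three majorants
    are summed separately. *)
Lemma noncollinear_sum :
  \sum_(1 <= n < k | ~~ collinear n) (n%:R * `|sres n|%:~R : R)^-1
    <= 2 * (Num.sqrt 2 / Num.sqrt k%:R) * (ln k%:R + 3).
Proof.
set q := Num.sqrt 2 / Num.sqrt k%:R.
have q0 : 0 < q by rewrite divr_gt0// sqrtr_gt0.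
have qge0 : 0 <= q := ltW q0.
have q2 : q ^+ 2 = 2 / k%:R by rewrite expr_div_n !sqr_sqrtr// ltW.
have ge_sqr (x c : R) : 0 <= x -> 0 <= c -> c ^+ 2 * k%:R <= 2 * x ^+ 2 -> c <= q * x.
  move=> x0 c0 hx; have qx0 : 0 <= q * x by rewrite mulr_ge0// ltW.
  rewrite -(@ler_pXn2r _ 2)// ?nnegrE//.
  by rewrite exprMn q2 mulrAC ler_pdivlMr.
have n_gt0 n : (0 < n < k)%N -> 0 < n%:R :> R by rewrite ltr0n => /andP[].
have s_gt0 n : (0 < n < k)%N -> 0 < `|sres n|%:~R :> R.
  by move=> nk; rewrite ltr0z normr_gt0 sres_neq0.
have inv_le (x c : R) : 0 < x -> 0 < c -> c <= q * x -> x^-1 <= q / c.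
  by move=> x0 c0 hx; rewrite ler_pdivlMr// mulrC ler_pdivrMr.
have nonc n : (0 < n < k)%N -> ~~ collinear n -> (n%:R * `|sres n|%:~R)^-1 <= q.
  move=> nk /(noncollinear_ge nk); rewrite -(ler_int R) => hn.
  rewrite -[leRHS]divr1; apply: inv_le => //; first exact: mulr_gt0 (n_gt0 n nk) (s_gt0 n nk).
  apply: ge_sqr => //.
  by move: hn; rewrite expr1n mul1r intrM rmorphXn /= intrM -!pmulrn.
(* The cut [sqrt (2 k)]. *)
pose X := 2 / q.
have X0 : 0 < X by rewrite divr_gt0.
have X2 : X ^+ 2 = 2 * k%:R.
  by rewrite expr_div_n q2; field; exact: lt0r_neq0.
have k1 : 1 <= k%:R :> R by rewrite ler1n ltnW.
have X1 : 1 <= X.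
  by rewrite -(@ler_pXn2r _ 2)// ?nnegrE ?ltW// X2 expr1n; lra.
have lnX : 2 * ln X = ln 2 + ln k%:R.
  by rewrite -lnM ?posrE// -X2 lnXn// mulr_natl.
apply: (@le_trans _ _ (\sum_(1 <= n < k)
   (q / 2 * `|sres n|%:~R^-1 + (if n%:R <= X then 2 * q * n%:R^-1 else 0)
    + (if ~~ collinear n && small n then (n%:R * `|sres n|%:~R : R)^-1 else 0)))).
  rewrite big_mkcond /=; apply: ler_sum_nat => n nk.
  have n0 := n_gt0 n nk; have s0 := s_gt0 n nk.
  have ni0 : 0 <= n%:R^-1 :> R by rewrite invr_ge0.
  have si0 : 0 <= `|sres n|%:~R^-1 :> R by rewrite invr_ge0 ltW.
  have i1 : 0 <= q / 2 * `|sres n|%:~R^-1 by apply: mulr_ge0 => //; exact: divr_ge0.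
  have i2 : 0 <= (if n%:R <= X then 2 * q * n%:R^-1 else 0).
    by case: ifP => // _; apply: mulr_ge0 => //; exact: mulr_ge0.
  have i3 : 0 <= (n%:R * `|sres n|%:~R : R)^-1 by rewrite invfM mulr_ge0.
  case: ifPn => ncol /=; last by rewrite addr0 addr_ge0.
  case: (boolP (small n)) => [_|]; first by rewrite lerDr addr_ge0.
  rewrite addr0 invfM negb_and -!leNgt => /orP[nbig|sbig].
    rewrite ler_wpDr// ler_wpM2r//; apply: inv_le => //; apply: ge_sqr => //.
    by move: nbig; rewrite -(ler_int R) intrM rmorphXn /= -!pmulrn => ?; lra.
  have i4 : `|sres n|%:~R^-1 <= 2 * q :> R.
    rewrite [2 * q]mulrC -[X in q * X]invrK; apply: inv_le; rewrite ?invr_gt0//.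
    apply: ge_sqr; rewrite ?invr_ge0//.
    move: sbig; rewrite -[sres n ^+ 2]real_normK ?num_real//.
    by rewrite -(ler_int R) intrM rmorphXn /= -!pmulrn => ?; lra.
  case: (lerP n%:R X) => [nX|nX].
    by rewrite ler_wpDl// mulrC ler_wpM2r.
  rewrite addr0 ler_wpM2r//; apply: inv_le => //.
  by rewrite mulrC -ler_pdivrMr// ltW.
rewrite !big_split /= -mulr_sumr -big_mkcond -big_mkcond /= -mulr_sumr.
have b1 : q / 2 * \sum_(1 <= n < k) `|sres n|%:~R^-1 <= q / 2 * (2 * (1 + ln k%:R)).
  by apply: ler_wpM2l; [exact: divr_ge0|exact: sum_inv_sres].
have b2 : 2 * q * \sum_(1 <= n < k | n%:R <= X) n%:R^-1 <= 2 * q * (1 + ln X).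
  by apply: ler_wpM2l; [exact: mulr_ge0|exact: harmonic_cut].
have b3 := small_sum (ltW q0) nonc.
have l2 : q * ln 2 <= q * 1 by apply: ler_wpM2l => //; exact: ln2_le1.
(* As [2 ln X = ln 2 + ln k <= 1 + ln k], the three bounds add up to at most [q (2 ln k + 6)]. *)
apply: le_trans (lerD (lerD b1 b2) b3) _.
rewrite (_ : 2 * q * (1 + ln X) = 2 * q + q * (2 * ln X)); last by ring.
by rewrite lnX; lra.
Qed.

(** The multiple [d (b, g)] contributes [sin (d th) / d^2] divided by [b |g|]. All [d < D] occur,
    where [D >= k / (2 b |g|)]; so the missing terms cost [4 / k], and the tail of the Clausen
    series costs another [2 / k]. *)
Lemma collinear_sum m :
  `|\sum_(1 <= n < k | collinear n) sin (m%:R * ang R h k n) / (n%:R * (sres n)%:~R)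
    - Cl2 (2 * pi * m%:R * `|g|%:~R / k%:R) / (b%:R * `|g|%:~R)| <= 6 / k%:R :> R.
Proof.
have [/andP[b0 bk] g0 latb minb] := bg_min.
have pi0 := pi_gt0 R.
have kE : k.-1.+1 = k by rewrite prednK// (ltn_trans _ k_gt1).
set th := 2 * pi * m%:R * `|g|%:~R / k%:R.
have th0 : 0 <= th by rewrite divr_ge0// mulr_ge0 ?ler0z// mulr_ge0// mulr_ge0// ltW.
have B0 : 0 < b%:R :> R by rewrite ltr0n.
have G0 : 0 < `|g|%:~R :> R by rewrite ltr0z normr_gt0.
have B1 : 1 <= b%:R :> R by rewrite ler1n.
have G1 : 1 <= `|g|%:~R :> R by rewrite ler1z -gtz0_ge1 normr_gt0.
pose Q d := collinear (d * b)%N && (d * b < k)%N.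
rewrite (@big_multiples _ _ _ b)//; last first.
  by move=> n nk /(collinear_multiple nk)[d [-> _]]; exact: dvdn_mull.
have termE d : (0 < d)%N -> Q d ->
    sin (m%:R * ang R h k (d * b)) / ((d * b)%:R * (sres (d * b))%:~R)
    = (b%:R * `|g|%:~R)^-1 * (sin (d%:R * th) / d%:R ^+ 2).
  move=> d0 /andP[col dbk].
  have [|d' [/eqP]] := collinear_multiple _ col; first by rewrite muln_gt0 d0 b0.
  rewrite eqn_pmul2r// => /eqP <- sE; rewrite /ang sE intrM natrM -pmulrn.
  have D0 : d%:R != 0 :> R by rewrite pnatr_eq0 -lt0n.
  rewrite /th; move: G0; rewrite intr_norm.
  have : (g%:~R : R) != 0 by rewrite intr_eq0.
  move: (g%:~R : R) (@pi R) => G p Gn0.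
  (* A change of sign of [g] flips both the sine and the denominator, so only [|g|] matters. *)
  case: (ltrP G 0) => [G_lt|G_ge]; [rewrite ltr0_norm//|rewrite ger0_norm//] => Gp.
    rewrite (_ : d%:R * (2 * p * m%:R * - G / k%:R) = - (m%:R * (2 * p * (d%:R * G) / k%:R)));
      last by ring.
    rewrite sinN; move: (sin _) => z; field.
    by rewrite D0 Gn0 (lt0r_neq0 B0).
  rewrite (_ : d%:R * (2 * p * m%:R * G / k%:R) = m%:R * (2 * p * (d%:R * G) / k%:R));
    last by ring.
  move: (sin _) => z; field.
  by rewrite D0 Gn0 (lt0r_neq0 B0).
rewrite big_nat_cond (eq_bigr (fun d => (b%:R * `|g|%:~R)^-1 * (sin (d%:R * th) / d%:R ^+ 2)));
  last by move=> d /andP[/andP[d0 _] Qd]; exact: termE.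
rewrite -big_nat_cond -mulr_sumr [Cl2 _ / _]mulrC -mulrBr normrM gtr0_norm; last first.
  by rewrite invr_gt0 mulr_gt0.
have Cl := Cl2_sin_sum k.-1 th0; rewrite kE in Cl.
(* [d < D] means [d K < k], hence [d b < k] and [2 d |g| < k]; the latter makes [d g] the least
   residue of [d b h]. *)
pose K := maxn b (2 * `|g|%N).
have K0 : (0 < K)%N by rewrite /K leq_max b0.
pose D := (k.-1 %/ K).+1.
have Q_small d : (0 < d < D)%N -> Q d.
  move=> /andP[d0]; rewrite /D ltnS leq_divRL// => dK.
  have dbk : (d * b < k)%N.
    by rewrite -kE ltnS (leq_trans _ dK)// leq_mul2l leq_maxl orbT.
  have dgk : (d * (2 * `|g|%N) < k)%N.
    by rewrite -kE ltnS (leq_trans _ dK)// leq_mul2l leq_maxr orbT.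
  rewrite /Q dbk andbT /collinear.
  have -> : sres (d * b) = d%:Z * g.
    apply: sres_lat_unique; last by rewrite normrM -abszE -[`|g|]abszE; lia.
    have [t tE] := latb; exists (d%:Z * t); rewrite tE PoszM; ring.
  by apply/eqP; rewrite PoszM; ring.
have rest : `|\sum_(1 <= d < k | Q d) sin (d%:R * th) / d%:R ^+ 2 - sin_sum k.-1 th|
    <= 2 / D%:R.
  rewrite /sin_sum kE [X in _ - X](bigID Q) /= opprD addrA subrr add0r normrN.
  apply: le_trans (ler_norm_sum _ _ _) _.
  apply: le_trans (_ : \sum_(D <= d < k) (d%:R ^- 2 : R) <= _); last exact: sum_inv_sqr_le.
  rewrite [leRHS](big_nat_widenl _ 1)//= big_nat_cond [leRHS]big_nat_cond.
  rewrite [leLHS]big_mkcond [leRHS]big_mkcond; apply: ler_sum => d _.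
  case: ifP => [/andP[/andP[d0 dk] nQ]|_]; last by case: ifP => // _; rewrite invr_ge0 sqr_ge0.
  rewrite d0 dk /= ifT; last first.
    by rewrite leqNgt; apply: contra nQ => dD; apply: Q_small; rewrite d0.
  rewrite normrM normfV [`|_ ^+ 2|]ger0_norm ?sqr_ge0//.
  by rewrite ler_piMl ?invr_ge0 ?sqr_ge0// sin_max.
(* [k <= D K], and [K <= 2 b |g|] because [b] and [|g|] are at least 1. *)
have DK : k%:R <= D%:R * (2 * (b%:R * `|g|%:~R)) :> R.
  rewrite -[`|g|]abszE -[(_%:Z)%:~R]/(`|g|%N%:R : R) -!natrM ler_nat.
  have h1 : (k <= D * K)%N by rewrite -{1}kE ltn_ceil.
  apply: leq_trans h1 _; rewrite leq_mul2l; apply/orP; right.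
  have : (0 < `|g|%N)%N by rewrite absz_gt0.
  rewrite /K geq_max => g1; nia.
rewrite mulrC ler_pdivrMr ?mulr_gt0//.
have D0 : 0 < D%:R :> R by rewrite ltr0n.
have rest2 : 2 / D%:R <= 4 * (b%:R * `|g|%:~R) / k%:R :> R.
  by rewrite ler_pdivrMr// mulrAC ler_pdivlMr//; lra.
set S := \sum_(_ <= _ < _ | _) _ in rest *.
have -> : S - Cl2 th = (S - sin_sum k.-1 th) - (Cl2 th - sin_sum k.-1 th) by ring.
apply: le_trans (ler_normB _ _) _.
apply: le_trans (lerD (le_trans rest rest2) Cl) _.
rewrite -mulrDl mulrAC ler_pM2r ?invr_gt0//.
by have := mulr_ege1 B1 G1; move=> ?; lra.
Qed.

Lemma lattice_sum_approx m :
  `|\sum_(1 <= n < k) sin (m%:R * ang R h k n) / (n%:R * (sres n)%:~R)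
    - Cl2 (2 * pi * m%:R * `|g|%:~R / k%:R) / (b%:R * `|g|%:~R)|
  <= 2 * (Num.sqrt 2 / Num.sqrt k%:R) * (ln k%:R + 3) + 6 / k%:R :> R.
Proof.
rewrite (bigID collinear) /= addrAC addrC.
apply: le_trans (ler_normD _ _) _; apply: lerD; last exact: collinear_sum.
apply: le_trans noncollinear_sum.
apply: le_trans (ler_norm_sum _ _ _) _; apply: ler_sum => n _.
by rewrite normrM normfV normrM normr_nat intr_norm ler_piMl ?invr_ge0 ?mulr_ge0// sin_max.
Qed.

End LatticeSum.

(** * The explicit error bound *)

Lemma ln_le_sqrt (R : realType) (x : R) : 0 < x -> ln x <= Num.sqrt x.
Proof.
move=> x0; have s0 : 0 < Num.sqrt x by rewrite sqrtr_gt0.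
have -> : ln x = 2 * ln (Num.sqrt x).
  by rewrite -{1}(sqr_sqrtr (ltW x0)) lnXn// mulr_natl.
(* The tangent of [ln] at 2 gives [2 ln s <= s + 2 ln 2 - 2 <= s] for [s = sqrt x]. *)
have := ln_sub_le (ltr0Sn R 1) s0; have := ln2_le1 R.
move: (Num.sqrt x) (ln (Num.sqrt x)) => s l h1 h2; lra.
Qed.

Lemma error_term_le (R : realType) (m h k : nat) (beta0 gamma0 : int) :
    (1 < k)%N -> coprime h k -> (m < k)%N -> Zmin h k (beta0, gamma0) ->
  `|error_term R m h k beta0 gamma0|
    <= (1605 / 100 + Num.sqrt 2 / pi * ln k%:R) / Num.sqrt k%:R.
Proof.
move=> k1 co mk zmin.
have [b [g [bg gE bgE]]] : exists (b : nat) (g : int),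
    [/\ lat_min h k b g, `|g| = gamma0 & `|beta0 * gamma0| = b%:Z * `|g| ].
  exact: Zmin_lat_min.
have k0 : 0 < k%:R :> R by rewrite ltr0n (ltn_trans _ k1).
have A := @ln_sinprod_approx R h k k1 co m mk.
have B := @lattice_sum_approx R h k k1 co b g bg m.
rewrite /error_term bgE -gE intrM -pmulrn.
move: A B; set L := k%:R^-1 * _; set S := \sum_(_ <= _ < _) _; set c := Cl2 _.
set G := b%:R * _; set q := Num.sqrt 2 / Num.sqrt k%:R.
move: (@pi R) (pi_gt0 R) (pi_ge2 R) L S c => p p0 p2 L S c A B.
have -> : L - c / (2 * p * G) = (L - (2 * p)^-1 * S) + (2 * p)^-1 * (S - c / G).
  by rewrite invfM; ring.
apply: le_trans (ler_normD _ _) _; rewrite normrM [`|(2 * p)^-1|]gtr0_norm; last first.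
  by rewrite invr_gt0 mulr_gt0.
have {}B : (2 * p)^-1 * `|S - c / G| <= (2 * p)^-1 * (2 * q * (ln k%:R + 3) + 6 / k%:R).
  by apply: ler_wpM2l => //; rewrite invr_ge0 mulr_ge0// ltW.
apply: le_trans (lerD A B) _.
have s0 : 0 < Num.sqrt k%:R :> R by rewrite sqrtr_gt0.
have sl := ln_le_sqrt k0.
have s1 : 1 <= Num.sqrt k%:R :> R.
  have k1R : 1 <= k%:R :> R by rewrite ler1n ltnW.
  by have : Num.sqrt 1 <= Num.sqrt k%:R :> R by [rewrite ler_sqrt]; rewrite sqrtr1.
have kE : k%:R = Num.sqrt k%:R ^+ 2 :> R by rewrite sqr_sqrtr// ltW.
rewrite /q.
have r2 : Num.sqrt 2 <= 2 :> R.
  by rewrite -(@ler_pXn2r _ 2)// ?nnegrE ?sqrtr_ge0// sqr_sqrtr//; lra.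
have r0 : 0 <= Num.sqrt 2 :> R := sqrtr_ge0 _.
rewrite ler_pdivlMr//.
move: (Num.sqrt 2) (ln k%:R) r2 r0 sl => r l r2 r0 sl.
move: (Num.sqrt k%:R) kE s0 s1 sl => s -> s0 s1 sl.
(* After multiplication by [s = sqrt k] only [(sqrt 2 / pi) ln k] is unbounded; the rest is at most
   [11/2 + 7/2 + 3 + 3/2 = 13.5], below 16.05. *)
have -> : ((11 / 2 + 7 / 2 * l) / s ^+ 2 + (2 * p)^-1 * (2 * (r / s) * (l + 3) + 6 / s ^+ 2)) * s
   = r / p * l + (11 / 2 / s + 7 / 2 * (l / s) + 3 * (r / p) + 3 / p / s).
  by field; rewrite (lt0r_neq0 p0) (lt0r_neq0 s0).
rewrite [leRHS]addrC lerD2l.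
have e1 : s^-1 <= 1 by rewrite invf_le1.
have e2 : l / s <= 1 by rewrite ler_pdivrMr// mul1r.
have e3 : r / p <= 1 by rewrite ler_pdivrMr// mul1r; lra.
have e4 : 3 / p / s <= 3 / 2.
  rewrite -mulrA -invfM ler_pM2l// lef_pV2 ?posrE ?mulr_gt0//.
  by rewrite -[2]mulr1 ler_pM.
lra.
Qed.

Theorem theorem2p1 (R : realType) :
  (exists C : R, forall (m h k : nat) (beta0 gamma0 : int),
      (1 <= h < k)%N -> coprime h k -> (m < k)%N ->
      Zmin h k (beta0, gamma0) ->
      `|error_term R m h k beta0 gamma0|
        <= C * (ln k%:R / Num.sqrt k%:R)) /\
  (forall (m h k : nat) (beta0 gamma0 : int),
      (1 <= h < k)%N -> coprime h k -> (m < k)%N ->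
      Zmin h k (beta0, gamma0) ->
      `|error_term R m h k beta0 gamma0|
        <= (1605 / 100 + Num.sqrt 2 / pi * ln k%:R) / Num.sqrt k%:R).
Proof.
split; last first.
  by move=> m h k beta0 gamma0 /andP[h1 hk]; apply: error_term_le; exact: leq_ltn_trans hk.
(* As [k >= 2], the constant 16.05 is at most [(16.05 / ln 2) ln k]. *)
exists (1605 / 100 / ln 2 + Num.sqrt 2 / pi) => m h k beta0 gamma0 /andP[h1 hk] co mk zmin.
have k1 : (1 < k)%N := leq_ltn_trans h1 hk.
apply: le_trans (error_term_le R k1 co mk zmin) _.
have l2 : 0 < ln 2 :> R by rewrite ln_gt0// ltr1n.
have lk : ln 2 <= ln k%:R :> R.
  by rewrite ler_ln ?posrE ?ltr0n// ?ler_nat// (ltn_trans _ k1).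
have : 0 <= 1605 / 100 :> R by apply: divr_ge0; exact: ler0n.
move: (1605 / 100) (Num.sqrt 2 / pi) => c r c0.
rewrite [leRHS]mulrA; apply: ler_wpM2r; first by rewrite invr_ge0 sqrtr_ge0.
by rewrite [leRHS]mulrDl lerD2r [leRHS]mulrAC ler_pdivlMr// ler_wpM2l.
Qed.
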